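(* Let $d\ge2$ and let $\Pi$ be the homogeneous Poisson process on the unit sphere $\mathbb{S}^{d-1}\subset\mathbb{R}^d$ with total intensity $n$. Then for every $t>0$ $$\lim_{n\to\infty}\mathbf{P}\left\{n^{\frac{4}{d-1}}(2-\operatorname{diam}(\Pi))\le t\right\}=1-\exp\left\{-\tfrac12\,c\,t^{\frac{d-1}{2}}\right\},$$ where $$c=\frac{2^{d-1}\,\Gamma(\frac d2)}{(d-1)\,\pi^{1/2}\,\Gamma(\frac{d-1}{2})}.$$
   Context: The homogeneous Poisson process on $\mathbb{S}^{d-1}$ with total intensity $n$ is the Poisson process with intensity measure $n\,\mu_{d-1}(\cdot)/\mu_{d-1}(\mathbb{S}^{d-1})$, where $\mu_{d-1}$ is the surface area measure on $\mathbb{S}^{d-1}$. $\operatorname{diam}(F)=\sup_{x,y\in F}\|x-y\|$ (the value assigned to the empty set is immaterial for the limit). $\Gamma$ is the Gamma function. *)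

(* Defs.v *)
From HB Require Import structures.
From mathcomp Require Import all_boot all_order all_algebra.
From mathcomp Require Import all_classical all_reals all_analysis.
From mathcomp Require Import measurable_realfun.
Import Order.TTheory GRing.Theory Num.Theory.
Import numFieldNormedType.Exports.

Set Implicit Arguments.
Unset Strict Implicit.
Unset Printing Implicit Defensive.

Local Open Scope classical_set_scope.
Local Open Scope ring_scope.

Definition Gamma (R : realType) (a : R) : R :=
  (\int[lebesgue_measure]_(x in `]0%R, +oo[) (x `^ (a - 1) * expR (- x)))%R.

Definition enorm (R : realType) (d : nat) (x : d.-tuple R) : R :=
  Num.sqrt (\sum_(i < d) tnth x i ^+ 2).

Definition edist (R : realType) (d : nat) (x y : d.-tuple R) : R :=
  enorm [tuple tnth x i - tnth y i | i < d].

(* [sup set0 = 0], so the empty set is assigned diameter 0. *)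
Definition diam (R : realType) (d : nat) (F : set (d.-tuple R)) : R :=
  sup [set edist p.1 p.2 | p in F `*` F].

Definition unit_sphere (R : realType) (d : nat) : set (d.-tuple R) :=
  [set x | enorm x = 1].
Arguments unit_sphere : clear implicits.

(* Lebesgue measure on R^d, as the d-fold product of the one-dimensional one:
   the successor case is the section formula defining [lebesgue_measure \x _],
   read through the identification of R^(d+1) with R * R^d. *)
Fixpoint lebesgue_Rd (R : realType) (d : nat) :
    set (d.-tuple R) -> \bar R :=
  match d with
  | 0 => fun A => \d_[tuple] A
  | d'.+1 => fun A =>
      (\int[lebesgue_measure]_x
         lebesgue_Rd [set y : d'.-tuple R | A [tuple of x :: y]])%E
  end.

Definition cone (R : realType) (d : nat) (A : set (d.-tuple R)) :
    set (d.-tuple R) :=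
  [set y | exists r x, [/\ 0 < r <= 1, A x &
                           y = [tuple r * tnth x i | i < d]]].

(* Surface area measure of the sphere in polar coordinates: since
   dx = r^(d-1) dr dmu(u), a Borel part A of the sphere spans a cone of volume
   mu(A) / d.  It is extended by 0 outside the sphere. *)
Definition surface_measure (R : realType) (d : nat) (A : set (d.-tuple R)) :
    \bar R :=
  (d%:R%:E * lebesgue_Rd (cone (A `&` unit_sphere R d)))%E.

Definition npoints (R : realType) (T : choiceType) (Omega : Type) (Pi : Omega -> set T)
    (A : set T) (w : Omega) : \bar R :=
  counting (Pi w `&` A).
Arguments npoints : clear implicits.
Arguments npoints R {T Omega}.

Definition mutually_independent (R : realType) (dO dE : measure_display)
    (Omega : measurableType dO) (E : measurableType dE)
    (P : probability Omega R) (m : nat) (X : 'I_m -> Omega -> E) : Prop :=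
  forall B : 'I_m -> set E, (forall i, measurable (B i)) ->
    P (\bigcap_(i in [set: 'I_m]) (X i @^-1` B i)) =
    (\prod_(i < m) P (X i @^-1` B i))%E.

(* A Poisson process is a random subset of T. The [else] branch makes the
   number of points in a set of infinite intensity almost surely infinite.
   The library's [poisson_pmf] is not used because [poisson_pmf 0 k = 1] for
   every k, whereas a set of intensity 0 must almost surely contain no point. *)
Definition poisson_process (R : realType) (dT dO : measure_display)
    (T : measurableType dT) (Omega : measurableType dO)
    (P : probability Omega R) (Lambda : set T -> \bar R)
    (Pi : Omega -> set T) : Prop :=
  [/\ forall A, measurable A -> measurable_fun setT (npoints R Pi A),
      forall A, measurable A -> forall k : nat,
        P [set w | npoints R Pi A w = k%:R%:E] =
        (if Lambda A is r%:E then (r ^+ k / k`!%:R * expR (- r))%:E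
         else 0%E) &
      forall (m : nat) (A : 'I_m -> set T),
        (forall i, measurable (A i)) -> trivIset setT A ->
        mutually_independent P (fun i => npoints R Pi (A i))].

Definition homogeneous_poisson_sphere (R : realType) (d : nat)
    (dO : measure_display) (Omega : measurableType dO)
    (P : probability Omega R) (gamma : R)
    (Pi : Omega -> set (d.-tuple R)) : Prop :=
  (forall w, Pi w `<=` unit_sphere R d) /\
  poisson_process P
    (fun A => (gamma%:E * (surface_measure A
                           / surface_measure (unit_sphere R d)))%E) Pi.

Definition limit_constant (R : realType) (d : nat) : R :=
  2 `^ (d%:R - 1) * Gamma (d%:R / 2) /
  ((d%:R - 1) * pi `^ (1 / 2) * Gamma ((d%:R - 1) / 2)).
Arguments limit_constant : clear implicits.

(* Main.v *)
Require Import Defs.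
From HB Require Import structures.
From mathcomp Require Import all_boot all_order all_algebra.
From mathcomp Require Import all_classical all_reals all_analysis.
From mathcomp Require Import measurable_realfun.
From mathcomp Require Import ring lra.
Import Order.TTheory GRing.Theory Num.Theory.
Import numFieldNormedType.Exports.

Local Open Scope classical_set_scope.
Local Open Scope ring_scope.

(** The diameter of the process is at least 2 - s exactly when, up to an
    arbitrarily small loss, some pair of points x, y has y in a small cap around
    the antipode of x. The number of such pairs behaves like a Poisson variable:
    the pairs are nearly independent, because two of them that share a point
    require three points of the process, which is much rarer. Hence the
    probability that there is no such pair tends to exp (- lambda), where lambda
    is the limit of the expected number of pairs, that is, of n^2 / 2 times the
    normalised measure of the cap.

    To make this rigorous the sphere is cut into finitely many small cells
    (fine_partition). By the definition of a Poisson process the random set of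
    occupied cells contains each cell independently (prob_occupied), so the
    question becomes one about a random subset of a finite set: how likely is it
    to contain no edge of a given graph? A product lower bound and Janson's
    inequality (avoid_edges_ge, avoid_edges_le) show that this probability is
    close to exp (- edge_mean). The graph joins cells that are nearly antipodal;
    a slightly larger and a slightly smaller graph bracket the event on the
    diameter (diam_prob_le, diam_prob_ge).

    It remains to find the measure of a small cap. It does not depend on the
    centre of the cap because Lebesgue measure is invariant under reflections
    (lebesgue_tuple_reflection), a consequence of translation invariance and
    Tonelli's theorem. The solid sector over the cap lies between two straight
    cones with the same opening angle (cap_cone_pole_le, cap_cone_pole_ge), so
    that for a cap of small angle theta on the sphere of R^d the normalised
    measure is equivalent to theta^(d-1) times a ratio of volumes of unit balls.
    These volumes are expressed through the Gamma function by the Gaussian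
    integral (ball_volume_gamma_integral, ball_volume_ratio). Finally, a distance
    2 - s corresponds to an angle equivalent to 2 s^(1/2), which explains the
    normalisation n^(4/(d-1)) of s and the factor 2^(d-1) of the constant. *)

(** * Inclusion probabilities in a random subset, and Janson's inequality *)

Section RandomSubset.
Import mathcomp.boot.finset.
Context {R : realType} {T : finType}.
Variable p : T -> R.
Hypothesis p01 : forall i, 0 <= p i <= 1.
Implicit Types (A S : {set T}) (F : seq {set T}).

Definition subset_weight A : R := \prod_i (if i \in A then p i else 1 - p i).

Definition incl_prob S : R := \prod_(i in S) p i.

Definition meets S S' : bool := ~~ [disjoint S & S']%B.

Definition avoids F A : bool := ~~ has (fun S => S \subset A) F.

(** The probability that a random subset of T, which contains each i
    independently with probability p i, includes no member of the family F. *)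
Definition avoid_prob F : R := \sum_(A | avoids F A) subset_weight A.

Lemma subset_weight_ge0 A : 0 <= subset_weight A.
Proof.
apply: prodr_ge0 => i _; have /andP[p0 p1] := p01 i.
by case: ifP => // _; rewrite subr_ge0.
Qed.

Lemma incl_prob_ge0 S : 0 <= incl_prob S.
Proof. by apply: prodr_ge0 => i _; have /andP[] := p01 i. Qed.

Lemma avoid_prob_ge0 F : 0 <= avoid_prob F.
Proof. by apply: sumr_ge0 => A _; exact: subset_weight_ge0. Qed.

Lemma sum_subset_weight : \sum_A subset_weight A = 1.
Proof.
transitivity (\prod_(i : T) (p i + (1 - p i))); first by rewrite bigA_distr.
by rewrite big1// => i _; rewrite addrC subrK.
Qed.

Lemma avoid_prob_nil : avoid_prob [::] = 1.
Proof. by rewrite -sum_subset_weight; apply: eq_bigl. Qed.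

(** Conditionally on containing i, the rest of the random subset keeps its
    law; that law does not see whether i was in the subset before. *)
Lemma sum_subset_weight_mem (i : T) (f : {set T} -> R) :
  \sum_(A : {set T} | i \in A) subset_weight A * f A =
  p i * \sum_A subset_weight A * f (i |: A).
Proof.
pose v A : R := \prod_(j | j != i) (if j \in A then p j else 1 - p j).
have vE A : subset_weight A = (if i \in A then p i else 1 - p i) * v A.
  by rewrite /subset_weight (bigD1 i).
have vU A : v (i |: A) = v A.
  by apply: eq_bigr => j ji; rewrite in_setU1 (negbTE ji).
have off : \sum_(A : {set T} | i \notin A) subset_weight A * f (i |: A) =
    (1 - p i) * \sum_(A : {set T} | i \in A) v A * f A.
  rewrite mulr_sumr (reindex_onto (fun A => A :\ i) (fun A => i |: A))/=; last first.
    by move=> A iA; rewrite setU1K.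
  apply: eq_big => [A|A /andP[_ /eqP AE]].
    rewrite setD11/=; apply/eqP/idP => [<-|iA]; first by rewrite setU11.
    by rewrite setD1K.
  by rewrite AE vE setD11 -(vU (A :\ i)) AE mulrA.
have on : \sum_(A : {set T} | i \in A) subset_weight A * f (i |: A) =
    p i * \sum_(A : {set T} | i \in A) v A * f A.
  rewrite mulr_sumr; apply: eq_bigr => A iA.
  by rewrite vE iA mulrA (setUidPr _)// sub1set.
rewrite [in RHS](bigID (fun A : {set T} => i \in A))/= on off -mulrDl addrC subrK mul1r.
rewrite mulr_sumr; apply: eq_bigr => A iA.
by rewrite vE iA mulrA.
Qed.

(** All correlation estimates below come from this identity: conditioning on
    the event that S is included amounts to adding S to the random subset. *)
Lemma sum_subset_weight_sup S (f : {set T} -> R) :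
  \sum_(A : {set T} | S \subset A) subset_weight A * f A =
  incl_prob S * \sum_A subset_weight A * f (A :|: S).
Proof.
elim: {S}#|S| {-2}S (leqnn #|S|) f => [|n IH] S Sn f.
  move: Sn; rewrite leqn0 cards_eq0 => /eqP->.
  rewrite /incl_prob big_set0 mul1r; apply: eq_big => [A|A _]; first by rewrite sub0set.
  by rewrite setU0.
have [->|[i iS]] := set_0Vmem S.
  rewrite /incl_prob big_set0 mul1r; apply: eq_big => [A|A _]; first by rewrite sub0set.
  by rewrite setU0.
pose S' := S :\ i.
have iS' : i \notin S' by rewrite setD11.
have SE : S = i |: S' by rewrite setD1K.
have cS' : (#|S'| <= n)%N by move: Sn; rewrite (cardsD1 i) iS.
pose g A := (i \in A)%:R * f A.
transitivity (\sum_(A : {set T} | S' \subset A) subset_weight A * g A).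
  rewrite [RHS](bigID (fun A : {set T} => i \in A))/= [RHS]addrC [X in _ = X + _]big1 ?add0r.
    rewrite {1}SE; apply: eq_big => [A|A]; first by rewrite subUset sub1set andbC.
    by rewrite subUset sub1set => /andP[iA _]; rewrite /g iA mul1r.
  by move=> A /andP[_ /negbTE iA]; rewrite /g iA mul0r mulr0.
rewrite IH//.
transitivity (incl_prob S' *
    \sum_(A : {set T} | i \in A) subset_weight A * f (A :|: S')).
  congr (_ * _); rewrite (bigID (fun A : {set T} => i \in A))/= addrC big1 ?add0r.
    by apply: eq_bigr => A iA; rewrite /g in_setU iA mul1r.
  by move=> A iA; rewrite /g in_setU (negbTE iA) (negbTE iS') mul0r mulr0.
rewrite (sum_subset_weight_mem i (fun A => f (A :|: S'))) mulrA.
congr (_ * _).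
  by rewrite SE /incl_prob big_setU1//= mulrC.
by apply: eq_bigr => A _; rewrite SE setUCA setUA.
Qed.

Definition incl_avoid_prob S F : R :=
  \sum_(A : {set T} | (S \subset A) && avoids F A) subset_weight A.

Let incl_avoid_probE S F : incl_avoid_prob S F =
  incl_prob S * \sum_A subset_weight A * (avoids F (A :|: S))%:R.
Proof.
rewrite -(sum_subset_weight_sup S (fun A => (avoids F A)%:R)).
rewrite /incl_avoid_prob big_mkcondr/=.
by apply: eq_bigr => A _; case: ifP; rewrite ?mulr1 ?mulr0.
Qed.

Let avoid_probE F : avoid_prob F = \sum_A subset_weight A * (avoids F A)%:R.
Proof.
rewrite /avoid_prob big_mkcond/=.
by apply: eq_bigr => A _; case: ifP; rewrite ?mulr1 ?mulr0.
Qed.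

Lemma avoidsS F A S : avoids F (A :|: S) -> avoids F A.
Proof.
move=> /hasPn h; apply/hasPn => S' S'F; apply: contra (h _ S'F) => S'A.
by apply: (fintype.subset_trans S'A); exact: subsetUl.
Qed.

(** The needed case of Harris' inequality: adding points can only
    destroy the property of avoiding F. *)
Lemma incl_avoid_prob_le S F : incl_avoid_prob S F <= incl_prob S * avoid_prob F.
Proof.
rewrite incl_avoid_probE avoid_probE ler_wpM2l ?incl_prob_ge0//.
apply: ler_sum => A _; rewrite ler_wpM2l ?subset_weight_ge0//.
have [/avoidsS->//|_] := boolP (avoids F (A :|: S)).
exact: ler0n.
Qed.

Lemma incl_avoid_prob_disjoint S F :
  {in F, forall S', ~~ meets S S'} ->
  incl_avoid_prob S F = incl_prob S * avoid_prob F.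
Proof.
move=> SF; rewrite incl_avoid_probE avoid_probE; congr (_ * _).
apply: eq_bigr => A _; congr (_ * _%:R); congr nat_of_bool.
apply/negb_inj; rewrite /avoids !negbK; apply: eq_in_has => S' /SF SS'.
apply/idP/idP => [|S'A]; last exact: fintype.subset_trans (subsetUl _ _).
move: SS'; rewrite negbK => SS'.
move=> /fintype.subsetP h; apply/fintype.subsetP => i iS'.
have := h _ iS'; rewrite in_setU => /orP[//|iS].
by have := disjointFr SS' iS; rewrite iS'.
Qed.

Lemma avoid_prob_cons S F :
  avoid_prob (S :: F) = avoid_prob F - incl_avoid_prob S F.
Proof.
apply/eqP; rewrite eq_sym subr_eq; apply/eqP.
rewrite [LHS](bigID (fun A : {set T} => S \subset A))/= addrC; congr (_ + _).
  by apply: eq_bigl => A; rewrite /avoids/= negb_or andbC.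
by apply: eq_bigl => A; rewrite andbC.
Qed.

Lemma incl_prob_le1 S : incl_prob S <= 1.
Proof. by apply: prodr_ile1 => i _; exact: p01. Qed.

(** Conditioning on avoiding some sets makes the inclusion of one more set
    less likely, so the members of F are avoided at least as often as if the
    inclusions were independent events. *)
Lemma avoid_prob_ge F : \prod_(S <- F) (1 - incl_prob S) <= avoid_prob F.
Proof.
elim: F => [|S F IH]; first by rewrite big_nil avoid_prob_nil.
rewrite big_cons avoid_prob_cons.
apply: (@le_trans _ _ ((1 - incl_prob S) * avoid_prob F)).
  by rewrite ler_wpM2l// subr_ge0 incl_prob_le1.
by rewrite mulrBl mul1r lerD2l lerN2 incl_avoid_prob_le.
Qed.

Lemma avoid_prob_sub F F' : {subset F <= F'} -> avoid_prob F' <= avoid_prob F.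
Proof.
move=> FF'; rewrite !avoid_probE; apply: ler_sum => A _.
rewrite ler_wpM2l ?subset_weight_ge0// ler_nat.
have [/hasPn h|//] := boolP (avoids F' A).
by rewrite (_ : avoids F A)//; apply/hasPn => S /FF'/h.
Qed.

(** Splits F into the members disjoint from S, which are independent of the
    inclusion of S, and the members that meet S, for which a union bound is
    accurate enough because two overlapping inclusions are rarely simultaneous. *)
Lemma incl_avoid_prob_ge S F :
  (incl_prob S - \sum_(S' <- F | meets S S') incl_prob (S :|: S')) *
    avoid_prob [seq S' <- F | ~~ meets S S'] <= incl_avoid_prob S F.
Proof.
set F0 := seq.filter _ F.
have dF0 : {in F0, forall S', ~~ meets S S'}.
  by move=> S'; rewrite mem_filter => /andP[].
rewrite mulrBl -incl_avoid_prob_disjoint// lerBlDr.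
pose hit A : R := \sum_(S' <- F | meets S S') (S' \subset A)%:R.
apply: (@le_trans _ _ (incl_avoid_prob S F +
    \sum_(A : {set T} | (S \subset A) && avoids F0 A) subset_weight A * hit A)).
  rewrite /incl_avoid_prob [in X in _ <= X + _](eq_bigl (fun A =>
    ((S \subset A) && avoids F0 A) && avoids F A)); last first.
    move=> A; rewrite -andbA; congr andb; apply/idP/idP => [h|/andP[]//].
    rewrite h andbT; apply/hasPn => S'; rewrite mem_filter => /andP[_].
    by move: h => /hasPn; apply.
  rewrite [X in _ <= X + _]big_mkcondr -big_split/=; apply: ler_sum => A /andP[SA aA].
  have hit0 : 0 <= hit A by apply: sumr_ge0 => S' _; exact: ler0n.
  case: ifP => [_|naA]; first by rewrite lerDl mulr_ge0// subset_weight_ge0.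
  rewrite add0r ler_peMr ?subset_weight_ge0//.
  move/negbFE : naA => /hasP[S' S'F S'A].
  have nd : meets S S'.
    by apply: contraT => d; move: aA => /hasPn/(_ S'); rewrite mem_filter d S'F S'A => /(_ isT).
  rewrite /hit (big_rem S' S'F)/= nd S'A lerDl.
  by apply: sumr_ge0 => S'' _; exact: ler0n.
rewrite lerD2l /hit.
under eq_bigr do rewrite mulr_sumr.
rewrite exchange_big/= mulr_suml; apply: ler_sum => S' _.
apply: le_trans (incl_avoid_prob_le _ _).
rewrite /incl_avoid_prob [leRHS](eq_bigl (fun A =>
  ((S \subset A) && avoids F0 A) && (S' \subset A))); last first.
  by move=> A; rewrite subUset -!andbA; congr andb; rewrite andbC.
rewrite [leRHS]big_mkcondr/=; apply: ler_sum => A _.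
by case: ifP; rewrite ?mulr1 ?mulr0.
Qed.

(** Janson's inequality. The hypothesis says that, given the inclusion of a
    member of F, the expected number of other included members that meet it is
    at most eps; the inclusions are then close to independent, and each new member
    multiplies the avoidance probability by at most exp (- (1 - eps) incl_prob S). *)
Lemma avoid_prob_le (eps : R) F : uniq F ->
  {in F, forall S, \sum_(S' <- F | (S' != S) && meets S S')
     incl_prob (S :|: S') <= eps * incl_prob S} ->
  avoid_prob F <= expR (- ((1 - eps) * \sum_(S <- F) incl_prob S)).
Proof.
elim: F => [_ _|S F IH /= /andP[SF uF] h].
  by rewrite big_nil mulr0 oppr0 expR0 avoid_prob_nil.
have {}IH : avoid_prob F <= expR (- ((1 - eps) * \sum_(S <- F) incl_prob S)).
  apply: IH => // S1 S1F; have := h S1; rewrite inE S1F orbT => /(_ isT).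
  apply: le_trans; rewrite big_cons; case: ifP => // _.
  by rewrite lerDr incl_prob_ge0.
rewrite big_cons mulrDr opprD expRD.
have bS : (1 - eps) * incl_prob S <=
    incl_prob S - \sum_(S' <- F | meets S S') incl_prob (S :|: S').
  have := h S; rewrite inE eqxx => /(_ isT); rewrite big_cons eqxx/=.
  rewrite (_ : \sum_(S' <- F | (S' != S) && _) _ =
    \sum_(S' <- F | meets S S') incl_prob (S :|: S')); last first.
    rewrite big_seq_cond [RHS]big_seq_cond; apply: eq_bigl => S'.
    by case: (boolP (S' \in F)) => //= S'F; have [SS'|//] := eqVneq S' S; rewrite -SS' S'F in SF.
  by move=> ?; lra.
rewrite avoid_prob_cons.
have := incl_avoid_prob_ge S F.
set b := (X in X * _); set F0 := seq.filter _ F => bF0.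
apply: (@le_trans _ _ (expR (- ((1 - eps) * incl_prob S)) * avoid_prob F)); last first.
  by rewrite ler_wpM2l// expR_ge0.
have F0F : avoid_prob F <= avoid_prob F0.
  by apply: avoid_prob_sub => S'; rewrite mem_filter => /andP[].
have inc0 : 0 <= incl_avoid_prob S F.
  by apply: sumr_ge0 => A _; exact: subset_weight_ge0.
have e1 := expR_ge1Dx (- ((1 - eps) * incl_prob S)).
have aF := avoid_prob_ge0 F.
have [b0|b0] := leP 0 ((1 - eps) * incl_prob S).
  have bb : (1 - eps) * incl_prob S * avoid_prob F <= incl_avoid_prob S F.
    apply: le_trans bF0; apply: ler_pM => //.
  have : (1 + - ((1 - eps) * incl_prob S)) * avoid_prob F <=
    expR (- ((1 - eps) * incl_prob S)) * avoid_prob F by rewrite ler_wpM2r.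
  lra.
have : 1 * avoid_prob F <= expR (- ((1 - eps) * incl_prob S)) * avoid_prob F.
  by rewrite ler_wpM2r//; lra.
lra.
Qed.

End RandomSubset.

Section RandomGraph.
Import mathcomp.boot.finset.
Context {R : realType} {m : nat}.
Variables (p : 'I_m -> R) (e : rel 'I_m).
Hypothesis p01 : forall i, 0 <= p i <= 1.
Hypothesis e_sym : symmetric e.
Hypothesis e_irr : irreflexive e.

Definition edge_pairs : seq ('I_m * 'I_m) :=
  [seq ij : 'I_m * 'I_m <- enum {: 'I_m * 'I_m} | (ij.1 < ij.2)%N && e ij.1 ij.2].

Definition edges : seq {set 'I_m} := [seq [set ij.1; ij.2] | ij <- edge_pairs].

(** The expected number of edges of e inside the random subset: the factor
    1/2 compensates for the sum over ordered pairs. *)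
Definition edge_mean : R := 1 / 2 * \sum_i \sum_(j | e i j) p i * p j.

Let p0 i : 0 <= p i. Proof. by have /andP[] := p01 i. Qed.

Lemma mem_edge_pairs (ij : 'I_m * 'I_m) :
  (ij \in edge_pairs) = (ij.1 < ij.2)%N && e ij.1 ij.2.
Proof. by rewrite mem_filter mem_enum andbT. Qed.

Let ltn_ord_neq (i j : 'I_m) : (i < j)%N -> i != j.
Proof. by move=> ij; rewrite -val_eqE neq_ltn ij. Qed.

Lemma edges_uniq : uniq edges.
Proof.
rewrite map_inj_in_uniq; first by apply: filter_uniq; exact: enum_uniq.
move=> [i j] [k l]; rewrite !mem_edge_pairs/= => /andP[ij _] /andP[kl _] E.
have : i \in [set k; l] by rewrite -E set21.
have : j \in [set k; l] by rewrite -E set22.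
rewrite !in_set2 => /orP[]/eqP jE /orP[]/eqP iE; move: ij kl; subst => //.
- by rewrite ltnn.
- by move=> /ltn_trans h /h; rewrite ltnn.
- by rewrite ltnn.
Qed.

Lemma edges_avoids A :
  avoids edges A = [forall i in A, forall j in A, ~~ e i j].
Proof.
apply/hasPn/forall_inP => [h i iA|h S /mapP[[i j] ij ->]/=].
  apply/forall_inP => j jA; apply/negP => eij.
  wlog ij : i j iA jA eij / (i < j)%N.
    move=> w; have [ij|ji|/val_inj ij] := ltngtP i j; first exact: (w i j).
      by apply: (w j i) => //; rewrite e_sym.
    by rewrite ij e_irr in eij.
  have /h/negP : [set i; j] \in edges.
    by apply/mapP; exists (i, j) => //; rewrite mem_edge_pairs/= ij eij.
  by apply; apply/fintype.subsetP => k; rewrite in_set2 => /orP[]/eqP->.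
apply/negP => /fintype.subsetP ijA.
have iA : i \in A by rewrite ijA// set21.
have jA : j \in A by rewrite ijA// set22.
have /forall_inP/(_ j jA) := h i iA.
by move: ij; rewrite mem_edge_pairs/= => /andP[_ ->].
Qed.

Let incl_prob2 (i j : 'I_m) : (i < j)%N -> incl_prob p [set i; j] = p i * p j.
Proof.
by move=> ij; rewrite /incl_prob big_setU1 ?big_set1//= in_set1 ltn_ord_neq.
Qed.

Lemma sum_edges : \sum_(S <- edges) incl_prob p S = edge_mean.
Proof.
rewrite big_map big_filter big_enum_cond/=.
transitivity (\sum_(i < m) \sum_(j < m | (i < j)%N && e i j) p i * p j).
  rewrite pair_big_dep/=; apply: eq_big => [[i j]//|[i j]/= /andP[ij _]].
  exact: incl_prob2.
rewrite /edge_mean.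
set U := LHS.
suff -> : \sum_i \sum_(j | e i j) p i * p j = U + U by lra.
rewrite [X in X + _](_ : U = \sum_(i < m) \sum_(j < m | (j < i)%N && e i j) p i * p j); last first.
  rewrite /U; under eq_bigr do rewrite big_mkcond/=.
  rewrite exchange_big/=; apply: eq_bigr => i _.
  rewrite -big_mkcond/=; apply: eq_big => [j|j _]; first by rewrite e_sym.
  by rewrite mulrC.
rewrite -big_split/=; apply: eq_bigr => i _.
rewrite (bigID (fun j : 'I_m => (j < i)%N))/=; congr (_ + _).
  by apply: eq_bigl => j; rewrite andbC.
apply: eq_bigl => j; rewrite andbC -leqNgt leq_eqVlt.
have [/val_inj->|//] := eqVneq (val i) (val j).
by rewrite e_irr !andbF.
Qed.

Lemma avoid_edges_ge (eta : R) : eta < 1 -> (forall i, p i <= eta) ->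
  expR (- (edge_mean / (1 - eta))) <= avoid_prob p edges.
Proof.
move=> eta1 peta; apply: le_trans (avoid_prob_ge p p01 _).
rewrite -sum_edges mulr_suml -sumrN expR_sum.
rewrite big_seq [leRHS]big_seq; apply: ler_prod => S /mapP[[i j]].
rewrite mem_edge_pairs/= => /andP[ij eij] ->; rewrite expR_ge0/= incl_prob2//.
have x0 : 0 <= p i * p j by rewrite mulr_ge0.
have xe : p i * p j <= eta.
  apply: le_trans (peta i); rewrite ler_piMr//; by have /andP[] := p01 j.
set x := p i * p j in x0 xe *.
have d0 : 0 < 1 - eta by lra.
rewrite expRN; have := expR_ge1Dx (x / (1 - eta)) => h.
have h2 : (1 - x)^-1 <= 1 + x / (1 - eta).
  have x1 : 0 < 1 - x by lra.
  have -> : (1 - x)^-1 = 1 + x / (1 - x) by field; lra.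
  rewrite lerD2l ler_wpM2l// lef_pV2 ?posrE//; lra.
have x1 : 0 < 1 - x by lra.
by rewrite -[leRHS]invrK lef_pV2 ?posrE ?expR_gt0 ?invr_gt0//; lra.
Qed.

(** A second edge that shares an endpoint i with a given one is determined by a
    neighbour of i, which is in the random subset with probability at most D in
    total. There are two endpoints, each of which can be the smaller or the
    larger endpoint of the new edge, hence the factor 4. *)
Lemma avoid_edges_le (D : R) : (forall i, \sum_(j | e i j) p j <= D) ->
  avoid_prob p edges <= expR (- ((1 - 4 * D) * edge_mean)).
Proof.
move=> degD; rewrite -sum_edges; apply: avoid_prob_le => //; first exact: edges_uniq.
move=> S /mapP[[i j]]; rewrite mem_edge_pairs/= => /andP[ij eij] ->.
have ji : j != i by rewrite eq_sym ltn_ord_neq.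
rewrite incl_prob2// big_map big_filter_cond/= big_enum_cond/=.
have pU k : k != i -> k != j -> incl_prob p [set k; i; j] = p k * (p i * p j).
  move=> ki kj; rewrite -setUA /incl_prob big_setU1/= ?in_set2; last by rewrite negb_or ki kj.
  by rewrite -incl_prob2.
pose c (k a b : 'I_m) : R := (e a b && (a == k))%:R * p b.
have c0 k a b : 0 <= c k a b by rewrite mulr_ge0.
have cD k : \sum_a \sum_b c k a b <= D.
  rewrite (bigD1 k)//= [X in _ + X]big1 ?addr0; last first.
    by move=> a /negbTE ak; rewrite big1// => b _; rewrite /c ak andbF mul0r.
  apply: le_trans (degD k); rewrite [leRHS]big_mkcond/=; apply: ler_sum => b _.
  by rewrite /c eqxx andbT; case: ifP; rewrite ?mul1r ?mul0r.
have cD' k : \sum_a \sum_b c k b a <= D by rewrite exchange_big/=.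
apply: (@le_trans _ _ (\sum_a \sum_b p i * p j * (c i a b + c i b a + (c j a b + c j b a)))).
  rewrite [leRHS]pair_bigA/= big_mkcond/=; apply: ler_sum => -[a b] _ /=.
  case: ifP => [|_]; last by rewrite !mulr_ge0// !addr_ge0.
  move=> /andP[/andP[ab eab] /andP[nE nD]].
  have eba : e b a by rewrite e_sym.
  have pp : 0 <= p i * p j by rewrite mulr_ge0.
  have ba : b != a by rewrite eq_sym ltn_ord_neq.
  have [k kS kS'] : exists2 k, k \in [set i; j] & k \in [set a; b].
    by move: nD => /pred0Pn[k /= /andP[? ?]]; exists k.
  have third x y : x \in [set i; j] -> [set x; y] = [set a; b] -> y != x ->
     incl_prob p ([set i; j] :|: [set a; b]) = p y * (p i * p j) .
    move=> xij xyE yx; rewrite -pU; last 2 first.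
    - apply/eqP => yi; move: nE => /eqP; apply; rewrite -xyE yi.
      move: xij; rewrite in_set2 => /orP[]/eqP xE; move: yx; rewrite yi xE ?eqxx// => _.
      by rewrite setUC.
    - apply/eqP => yj; move: nE => /eqP; apply; rewrite -xyE yj.
      by move: xij; rewrite in_set2 => /orP[]/eqP xE; move: yx; rewrite yj xE ?eqxx.
    congr (incl_prob p _); rewrite -xyE; apply/setP => z'; rewrite !inE.
    move: xij; rewrite in_set2 => /orP[]/eqP->.
    - by case: (z' == i); case: (z' == j); case: (z' == y).
    - by case: (z' == i); case: (z' == j); case: (z' == y).
  have nnD (x1 x2 x3 x4 : R) : 0 <= x1 -> 0 <= x2 -> 0 <= x3 -> 0 <= x4 ->
    [/\ x1 <= x1 + x2 + (x3 + x4), x2 <= x1 + x2 + (x3 + x4), x3 <= x1 + x2 + (x3 + x4) &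
        x4 <= x1 + x2 + (x3 + x4)] by move=> *; split; lra.
  have [n1 n2 n3 n4] := nnD _ _ _ _ (c0 i a b) (c0 i b a) (c0 j a b) (c0 j b a).
  move: (kS) (kS'); rewrite !in_set2 => kij /orP[]/eqP kE; subst k.
  - rewrite (third a b)// 1?mulrC ?ler_wpM2l//.
    have -> : p b = c a a b by rewrite /c eab eqxx mul1r.
    move: kij => /orP[]/eqP aE.
      by rewrite (_ : c a a b = c i a b)// {1}aE.
    by rewrite (_ : c a a b = c j a b)// {1}aE.
  - rewrite (third b a)// 1?eq_sym// 1?setUC// 1?mulrC ?ler_wpM2l//.
    have -> : p a = c b b a by rewrite /c eba eqxx mul1r.
    move: kij => /orP[]/eqP bE.
      by rewrite (_ : c b b a = c i b a)// {1}bE.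
    by rewrite (_ : c b b a = c j b a)// {1}bE.
under eq_bigr do rewrite -mulr_sumr !big_split/=.
rewrite -mulr_sumr !big_split/= mulrC ler_wpM2r ?mulr_ge0//.
have := cD i; have := cD' i; have := cD j; have := cD' j; lra.
Qed.

End RandomGraph.

(** * Lebesgue measure on tuples *)

Section LebesgueMeasureLine.
Context {R : realType}.
Local Notation mu := (@lebesgue_measure R).

Lemma measurable_affine (a b : R) :
  measurable_fun setT (fun x : measurableTypeR R => a * x + b : measurableTypeR R).
Proof.
apply: measurable_funD; last exact: measurable_cst.
by apply: measurable_funM; [exact: measurable_cst|exact: measurable_id].
Qed.

(** Both sides define measures that agree on half-open intervals. *)
Lemma lebesgue_measure_affine (a b : R) (A : set R) : 0 < a -> measurable A ->
  mu ((fun x => a * x + b) @^-1` A) = (a^-1%:E * mu A)%E.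
Proof.
move=> a0 mA.
pose T (x : measurableTypeR R) : measurableTypeR R := a * x + b.
pose nu0 := measure_function_pushforward__canonical__measure_function_Measure
  mu (measurable_affine a b).
pose nu := [the measure _ _ of mscale (NngNum (ltW a0)) nu0].
have -> : mu A = nu A.
  apply: lebesgue_measure_unique => // X [[c e] /= _ <-].
  rewrite /nu/= /mscale/= /nu0/= /pushforward.
  rewrite [X in (_ * mu X)%E](_ : _ = `](c - b) / a, (e - b) / a]%classic); last first.
    apply/seteqP; split => x /=; rewrite !in_itv/= ltr_pdivrMr// ler_pdivlMr//
      ltrBlDr lerBrDr mulrC //.
  rewrite !lebesgue_measure_itv/= !lte_fin ltr_pM2r ?invr_gt0// ltrD2r.
  case: ifP => ce; last by rewrite mule0.
  rewrite -!EFinD -EFinM; congr EFin; field; lra.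
rewrite /nu/= /mscale/= muleA -EFinM mulVf ?gt_eqF// mul1e//.
Qed.

Lemma ge0_integral_affine (a b : R) (f : R -> \bar R) : 0 < a ->
  measurable_fun setT f -> (forall x, 0 <= f x)%E ->
  (\int[mu]_x f (a * x + b)%R = a^-1%:E * \int[mu]_x f x)%E.
Proof.
move=> a0 mf f0.
have ia0 : 0 <= a^-1 by rewrite invr_ge0 ltW.
rewrite -(ge0_integral_mscale mu measurableT (NngNum ia0))//.
rewrite -(ge0_integral_pushforward (measurable_affine a b) mu measurableT mf)//.
apply: eq_measure_integral .
  exact: measurable_affine.
by move=> ? A mA _; exact: lebesgue_measure_affine.
Qed.

End LebesgueMeasureLine.

Section ConsMeasure.
Context {R : realType} {d : nat}.
Variable m : {sigma_finite_measure set (d.-tuple R) -> \bar R}.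
Local Notation mu := (@lebesgue_measure R).

Definition cons_pair (xy : measurableTypeR R * d.-tuple R) : d.+1.-tuple R :=
  [tuple of xy.1 :: xy.2].

Lemma measurable_cons_pair : measurable_fun setT cons_pair.
Proof. exact: measurable_cons. Qed.

(** The image of a product measure, which turns the defining recursion of
    lebesgue_Rd into a construction of sigma-finite measures. *)
Definition cons_measure : set (d.+1.-tuple R) -> \bar R :=
  pushforward (mu \x m)%E cons_pair.

Let cons_measure0 : cons_measure set0 = 0%E.
Proof. by rewrite /cons_measure /pushforward preimage_set0 measure0. Qed.

Let cons_measure_ge0 A : (0 <= cons_measure A)%E.
Proof. by apply: integral_ge0 => x _; exact: measure_ge0. Qed.

Let cons_measure_sigma_additive : semi_sigma_additive cons_measure.
Proof.
exact: (@measure_semi_sigma_additive _ _ _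
  (measure_function_pushforward__canonical__measure_function_Measure
     (mu \x m)%E measurable_cons_pair)).
Qed.

HB.instance Definition _ := isMeasure.Build _ _ _ cons_measure
  cons_measure0 cons_measure_ge0 cons_measure_sigma_additive.

Let cons_measure_sigma_finite : sigma_finite setT cons_measure.
Proof.
have /sigma_finiteP[F [TF ndF Foo]] := sigma_finiteT mu.
have /sigma_finiteP[G [TG ndG Goo]] := sigma_finiteT m.
pose uncons (x : d.+1.-tuple R) := (tnth x ord0, [tuple of behead x]).
have munc : measurable_fun setT uncons.
  by apply/measurable_fun_pair; [exact: measurable_tnth|exact: measurable_behead].
have consK : cancel cons_pair uncons.
  move=> [x y]; rewrite /uncons /cons_pair/= tnth0; congr pair.
  by apply/val_inj.
exists (fun k => uncons @^-1` (F k `*` G k)).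
  rewrite -preimage_bigcup (_ : \bigcup_i _ = setT) ?preimage_setT//.
  rewrite predeqE => -[x y]; split => // _.
  have [n _ Fnx] : (\bigcup_i F i) x by rewrite -TF.
  have [k _ Gky] : (\bigcup_i G i) y by rewrite -TG.
  exists (maxn n k) => //; split.
  - by move: x Fnx; exact/subsetPset/ndF/leq_maxl.
  - by move: y Gky; exact/subsetPset/ndG/leq_maxr.
move=> k; have [mF Fk] := Foo k; have [mG Gk] := Goo k.
have mFG : measurable (F k `*` G k) by exact: measurableX.
split; first by rewrite -[X in measurable X]setTI; exact: munc.
rewrite /cons_measure /pushforward -comp_preimage.
rewrite (_ : uncons \o cons_pair = id); last by apply/funext => xy; exact: consK.
by rewrite preimage_id product_measure1E// lte_mul_pinfty// ge0_fin_numE.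
Qed.

HB.instance Definition _ := Measure_isSigmaFinite.Build _ _ _ cons_measure
  cons_measure_sigma_finite.

Lemma cons_measureE A : measurable A ->
  cons_measure A = (\int[mu]_x m [set y | A (cons_pair (x, y))])%E.
Proof.
move=> mA; apply: eq_integral => x _ /=; congr (m _).
by apply/seteqP; split => y; rewrite /xsection/= ?inE.
Qed.

Lemma ge0_integral_cons_measure (f : d.+1.-tuple R -> \bar R) :
  measurable_fun setT f -> (forall x, 0 <= f x)%E ->
  (\int[cons_measure]_z f z =
   \int[mu]_x \int[m]_y f (cons_pair (x, y)))%E.
Proof.
move=> mf f0.
rewrite (ge0_integral_pushforward measurable_cons_pair (mu \x m)%E measurableT mf)//.
rewrite preimage_setT fubini_tonelli1//.
  by apply: measurableT_comp => //; exact: measurable_cons_pair.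
by move=> xy; exact: f0.
Qed.

End ConsMeasure.

Section LebesgueTuple.
Context {R : realType}.
Local Notation mu := (@lebesgue_measure R).

Fixpoint lebesgue_tuple (d : nat) :
    {sigma_finite_measure set (d.-tuple R) -> \bar R} :=
  match d with
  | 0 => [the {sigma_finite_measure set (0.-tuple R) -> \bar R} of \d_[tuple]]
  | d'.+1 => [the {sigma_finite_measure set (d'.+1.-tuple R) -> \bar R} of
                cons_measure (lebesgue_tuple d')]
  end.

Lemma measurable_cons_section (d : nat) (A : set (d.+1.-tuple R)) (x : R) :
  measurable A -> measurable [set y : d.-tuple R | A (cons_pair (x, y))].
Proof.
move=> mA; rewrite -[X in measurable X]setTI.
by apply: (@measurable_cons _ _ (d.-tuple R) R (fun=> x) d id) => //.
Qed.

Lemma lebesgue_RdE (d : nat) (A : set (d.-tuple R)) : measurable A ->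
  lebesgue_Rd A = lebesgue_tuple d A.
Proof.
elim: d A => [//|d IH] A mA.
rewrite [RHS]cons_measureE//; apply: eq_integral => x _ /=.
by apply: IH; exact: measurable_cons_section.
Qed.


Lemma ge0_integral_lebesgue_tupleS (d : nat) (f : d.+1.-tuple R -> \bar R) :
  measurable_fun setT f -> (forall x, 0 <= f x)%E ->
  (\int[lebesgue_tuple d.+1]_z f z =
   \int[mu]_x \int[lebesgue_tuple d]_y f (cons_pair (x, y)))%E.
Proof. exact: ge0_integral_cons_measure. Qed.

Lemma lebesgue_tupleS (d : nat) (A : set (d.+1.-tuple R)) : measurable A ->
  lebesgue_tuple d.+1 A =
  (\int[mu]_x lebesgue_tuple d [set y | A (cons_pair (x, y))])%E.
Proof. exact: cons_measureE. Qed.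

Lemma measurable_fun_lebesgue_tuple_section (d : nat) (A : set (d.+1.-tuple R)) :
  measurable A ->
  measurable_fun setT (fun x : measurableTypeR R =>
    lebesgue_tuple d [set y | A (cons_pair (x, y))]).
Proof.
move=> mA.
have mA' : measurable (@cons_pair R d @^-1` A).
  by rewrite -[X in measurable X]setTI; exact: measurable_cons_pair.
rewrite (_ : (fun _ => _) =
    lebesgue_tuple d \o xsection (@cons_pair R d @^-1` A)).
  exact: measurable_fun_xsection.
apply/funext => x /=; congr (lebesgue_tuple d _).
by apply/seteqP; split => y; rewrite /xsection/= ?inE.
Qed.

(** The vector r y + v. All vector operations of the file are instances of this
    one: sums (r = 1), differences (r = -1) and multiples (v = 0). *)
Definition affine_tuple {d : nat} (r : R) (v y : d.-tuple R) : d.-tuple R :=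
  [tuple r * tnth y i + tnth v i | i < d].

Lemma measurable_affine_tuple (d : nat) (r : R) (v : d.-tuple R) :
  measurable_fun setT (affine_tuple r v).
Proof.
apply/measurable_fun_tnthP => i.
rewrite (_ : _ \o _ = fun y => r * tnth y i + tnth v i); last first.
  by apply/funext => y /=; rewrite tnth_mktuple.
apply: measurable_funD; last exact: measurable_cst.
by apply: measurable_funM; [exact: measurable_cst|exact: measurable_tnth].
Qed.

Lemma lebesgue_tuple_affine (d : nat) (r : R) (v : d.-tuple R)
    (A : set (d.-tuple R)) : 0 < r -> measurable A ->
  lebesgue_tuple d (affine_tuple r v @^-1` A) =
  ((r^-1 ^+ d)%:E * lebesgue_tuple d A)%E.
Proof.
move=> r0; elim: d v A => [|d IH] v A mA.
  rewrite expr0 mul1e; congr (_ _); apply/seteqP.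
  by split => y /=; rewrite [affine_tuple _ _ _]tuple0 [y]tuple0.
rewrite !lebesgue_tupleS//; last first.
  by rewrite -[X in measurable X]setTI; exact: measurable_affine_tuple.
pose g x := lebesgue_tuple d [set y | A (cons_pair (x, y))].
transitivity (\int[mu]_x ((r^-1 ^+ d)%:E * g (r * x + thead v)%R))%E.
  apply: eq_integral => x _.
  rewrite -(IH [tuple of behead v]); last exact: measurable_cons_section.
  congr (lebesgue_tuple d _); apply/funext => y /=; congr A.
  apply: eq_from_tnth => i; rewrite tnth_mktuple.
  case: (unliftP ord0 i) => [j ->|->]; last by rewrite !tnth0.
  rewrite !tnthS tnth_mktuple tnth_behead; congr (_ + tnth v _).
  by apply/val_inj; rewrite /= inordK// ltnS.
have mg : measurable_fun setT g by exact: measurable_fun_lebesgue_tuple_section.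
have mg' : measurable_fun setT (fun x : measurableTypeR R => g (r * x + thead v)).
  by apply: (measurableT_comp mg); exact: measurable_affine.
rewrite ge0_integralZl//; last by rewrite lee_fin exprn_ge0// invr_ge0 ltW.
by rewrite ge0_integral_affine// muleA -EFinM exprSr.
Qed.


End LebesgueTuple.

(** * Euclidean geometry and reflection invariance *)

Section Euclidean.
Context {R : realType} {d : nat}.
Implicit Types (x y z u v w : d.-tuple R) (r s : R).

Definition dot x y : R := \sum_(i < d) tnth x i * tnth y i.

Lemma dotC x y : dot x y = dot y x.
Proof. by apply: eq_bigr => i _; rewrite mulrC. Qed.

Lemma tnth_affine r v y i : tnth (affine_tuple r v y) i = r * tnth y i + tnth v i.
Proof. exact: tnth_mktuple. Qed.

Lemma dot_affine r v y w : dot (affine_tuple r v y) w = r * dot y w + dot v w.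
Proof.
rewrite /dot mulr_sumr -big_split/=; apply: eq_bigr => i _.
by rewrite tnth_affine mulrDl mulrA.
Qed.

Lemma dot_affiner r v y w : dot w (affine_tuple r v y) = r * dot w y + dot w v.
Proof. by rewrite dotC dot_affine ![dot w _]dotC. Qed.

Lemma dot_ge0 x : 0 <= dot x x.
Proof. by apply: sumr_ge0 => i _; rewrite -expr2 sqr_ge0. Qed.

Lemma dot_eq0 x : dot x x = 0 -> forall i, tnth x i = 0.
Proof.
move=> /eqP; rewrite psumr_eq0; last by move=> i _; rewrite -expr2 sqr_ge0.
move=> /allP h i; have := h i (mem_index_enum _).
by rewrite -expr2 sqrf_eq0 => /eqP.
Qed.

Lemma enormE x : enorm x = Num.sqrt (dot x x).
Proof. by []. Qed.

Lemma enorm_ge0 x : 0 <= enorm x. Proof. exact: sqrtr_ge0. Qed.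

Lemma sqr_enorm x : enorm x ^+ 2 = dot x x.
Proof. by rewrite enormE sqr_sqrtr// dot_ge0. Qed.

Lemma enorm_le x r : 0 <= r -> (enorm x <= r) = (dot x x <= r ^+ 2).
Proof. by move=> r0; rewrite -sqr_enorm ler_pXn2r// nnegrE enorm_ge0. Qed.

Definition zero_tuple : d.-tuple R := [tuple 0 | i < d].

Lemma dot0 x : dot zero_tuple x = 0.
Proof. by rewrite /dot big1// => i _; rewrite tnth_mktuple mul0r. Qed.

Lemma enorm_scale r x : 0 <= r -> enorm (affine_tuple r zero_tuple x) = r * enorm x.
Proof.
move=> r0; rewrite !enormE dot_affine dot0 addr0 dotC dot_affine dot0 addr0.
by rewrite mulrA -expr2 sqrtrM ?sqr_ge0// sqrtr_sqr ger0_norm.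
Qed.

Lemma edistE x y : Defs.edist x y = enorm (affine_tuple (-1) x y).
Proof.
congr (enorm _); apply: eq_from_tnth => i.
by rewrite tnth_affine tnth_mktuple mulN1r addrC.
Qed.

Lemma sqr_edist x y : Defs.edist x y ^+ 2 = dot x x + dot y y - 2 * dot x y.
Proof.
by rewrite edistE sqr_enorm !(dot_affine, dot_affiner) [dot y x]dotC; ring.
Qed.

Lemma measurable_dot {dX} {X : measurableType dX} (f g : X -> d.-tuple R) :
  measurable_fun setT f -> measurable_fun setT g ->
  measurable_fun setT (fun a => dot (f a) (g a)).
Proof.
move=> /measurable_fun_tnthP mf /measurable_fun_tnthP mg.
apply: measurable_sum => i; apply: measurable_funM; [exact: mf|exact: mg].
Qed.

Lemma measurable_enorm : measurable_fun setT (@enorm R d).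
Proof.
apply: (@measurableT_comp _ _ _ _ _ _ (@Num.sqrt R)) => //.
  apply: continuous_measurable_fun; exact: sqrt_continuous.
exact: measurable_dot.
Qed.

Lemma measurable_affine2 {dX} {X : measurableType dX} (c : X -> R)
    (f g : X -> d.-tuple R) :
  measurable_fun setT c -> measurable_fun setT f -> measurable_fun setT g ->
  measurable_fun setT (fun a => affine_tuple (c a) (f a) (g a)).
Proof.
move=> mc /measurable_fun_tnthP mf /measurable_fun_tnthP mg.
apply/measurable_fun_tnthP => i.
rewrite (_ : _ \o _ = fun a => c a * tnth (g a) i + tnth (f a) i); last first.
  by apply/funext => x /=; rewrite tnth_affine.
by apply: measurable_funD; [apply: measurable_funM => //; exact: mg|exact: mf].
Qed.

Definition origin_ball r : set (d.-tuple R) := [set x | enorm x <= r].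

Lemma measurable_origin_ball r : measurable (origin_ball r).
Proof.
rewrite (_ : origin_ball r = setT `&` (@enorm R d) @^-1` `]-oo, r]%classic).
  by apply: measurable_enorm => //; exact: measurable_itv.
by rewrite setTI; apply/seteqP; split => x /=; rewrite in_itv.
Qed.

(** The reflection in the hyperplane orthogonal to u; it is the identity when
    u = 0, since division by zero yields zero. *)
Definition reflection u y : d.-tuple R :=
  affine_tuple (- (2 * dot u y / dot u u)) y u.

Lemma reflection_dot u x y : dot (reflection u x) (reflection u y) = dot x y.
Proof.
rewrite /reflection !dot_affine !dot_affiner [dot x u]dotC.
have [u0|u0] := eqVneq (dot u u) 0.
  by have u_eq0 := dot_eq0 _ u0; have ux w : dot u w = 0;
    [rewrite /dot big1// => i _; rewrite u_eq0 mul0r|rewrite !ux; ring].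
by field.
Qed.

Lemma dot_reflection_u u y : dot u y = - dot u (reflection u y).
Proof.
rewrite /reflection dot_affiner.
have [u0|u0] := eqVneq (dot u u) 0.
  have u_eq0 := dot_eq0 _ u0.
  by rewrite u0 mulr0 add0r /dot big1 ?oppr0// => i _; rewrite u_eq0 mul0r.
by field.
Qed.

Lemma reflectionK u : involutive (reflection u).
Proof.
move=> y; apply: eq_from_tnth => i; rewrite tnth_affine.
rewrite [dot u (reflection _ _)](canRL (@opprK _) (esym (dot_reflection_u u y))).
by rewrite tnth_affine mulrN mulNr; ring.
Qed.

Lemma reflection_affine u r v y :
  reflection u (affine_tuple r v y) = affine_tuple r (reflection u v) (reflection u y).
Proof.
apply: eq_from_tnth => i; rewrite !tnth_affine dot_affiner; ring.
Qed.

(** Unit vectors are exchanged by the reflection in the hyperplane orthogonal to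
    their difference, so reflections act transitively on the sphere. *)
Lemma reflection_swap x z : dot x x = dot z z ->
  reflection (affine_tuple (-1) x z) x = z.
Proof.
move=> xz; apply: eq_from_tnth => i; rewrite /reflection.
set u := affine_tuple (-1) x z.
have uu : dot u u = 2 * dot u x.
  by rewrite /u !(dot_affine, dot_affiner) xz [dot z x]dotC; ring.
have [u0|u0] := eqVneq (dot u u) 0.
  have := dot_eq0 _ u0 i; rewrite tnth_affine u0 invr0 mulr0 oppr0 mul0r add0r.
  by rewrite tnth_affine => ?; lra.
by rewrite tnth_affine -uu divff// tnth_affine; ring.
Qed.

Lemma measurable_reflection u : measurable_fun setT (reflection u).
Proof.
apply: measurable_affine2 => //.
apply: measurable_funN; apply: measurable_funM => //.
by apply: measurable_funM => //; exact: measurable_dot.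
Qed.

End Euclidean.

Section ReflectionInvariance.
Context {R : realType} {d : nat}.
Local Notation mu := (@lebesgue_tuple R d).
Implicit Types (u v x y : d.-tuple R) (A B : set (d.-tuple R)).

Lemma measurable_preimageT {dX dY} {X : measurableType dX} {Y : measurableType dY}
    (f : X -> Y) (A : set Y) :
  measurable_fun setT f -> measurable A -> measurable (f @^-1` A).
Proof. by move=> mf mA; rewrite -[X in measurable X]setTI; exact: mf. Qed.

Lemma lebesgue_tuple_translate v A : measurable A ->
  mu (affine_tuple 1 v @^-1` A) = mu A.
Proof. by move=> mA; rewrite lebesgue_tuple_affine// invr1 expr1n mul1e. Qed.

Lemma integral_indicT A : measurable A -> (\int[mu]_x (\1_A x)%:E = mu A)%E.
Proof. by move=> mA; rewrite integral_indic// setIT. Qed.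

Lemma lebesgue_tuple_swap (G : set (d.-tuple R * d.-tuple R)) : measurable G ->
  (\int[mu]_x mu [set y | G (x, y)] = \int[mu]_y mu [set x | G (x, y)])%E.
Proof.
move=> mG.
have mf : measurable_fun setT (EFin \o \1_G : _ -> \bar R).
  by apply/measurable_EFinP; exact: measurable_indic.
have := @fubini_tonelli _ _ _ _ R mu mu (EFin \o \1_G) mf.
move=> /(_ (fun z => _)) => h.
transitivity (\int[mu]_x \int[mu]_y (EFin \o \1_G) (x, y))%E.
  apply: eq_integral => x _; rewrite -integral_indicT.
  - by apply: eq_integral => y _; rewrite /= !indicE.
  - exact: (measurable_preimageT (pair x)).
rewrite h; last by move=> z; rewrite lee_fin.
apply: eq_integral => y _; rewrite -integral_indicT.
- by apply: eq_integral => x _; rewrite /= !indicE.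
- exact: (measurable_preimageT (fun x => (x, y))).
Qed.

Lemma integral_indic_mule B (c : \bar R) : (0 <= c)%E -> measurable B ->
  (\int[mu]_x (if x \in B then c else 0) = mu B * c)%E.
Proof.
move=> c0 mB; rewrite -integral_indicT//.
rewrite -ge0_integralZr//.
- by apply: eq_integral => x _; rewrite indicE; case: ifP; rewrite ?mul1e ?mul0e.
- by apply/measurable_EFinP; exact: measurable_indic.
Qed.

(** Reflection invariance follows from translation invariance and Tonelli's
    theorem alone. Write N for the reflection, B for the unit ball, and compute
    the integral of 1_A(x) 1_B(x - N y) over all pairs (x, y) in two ways. For
    fixed x, the map y |-> x - N y translates -N y, and B = -B = N B, so the
    integral over y is the volume of B and the total is |A| |B|. For fixed y, the
    translation of x by N y turns the integrand into 1_B(x) 1_A(x + N y), whose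
    integral over y is the volume of N^-1 A because x = N (N x); the total is
    |B| |N^-1 A|. It remains to divide by |B|. *)
Lemma lebesgue_tuple_reflection u A : measurable A ->
  (0 < mu (origin_ball 1) < +oo)%E ->
  mu (reflection u @^-1` A) = mu A.
Proof.
move=> mA; pose B : set (d.-tuple R) := origin_ball 1; rewrite -/B => /andP[B0 Boo].
have mB : measurable B by exact: measurable_origin_ball.
have mR := measurable_reflection u.
have BN x : B (reflection u x) = B x.
  by rewrite /B /origin_ball/= !enormE reflection_dot.
have Bopp x : B (affine_tuple (-1) zero_tuple x) = B x.
  rewrite /B /origin_ball/= !enormE !(dot_affine, dot_affiner) !dot0 dotC dot0.
  by congr (Num.sqrt _ <= _); ring.
pose G := [set xy : d.-tuple R * d.-tuple R |
  A xy.1 /\ B (affine_tuple (-1) xy.1 (reflection u xy.2))].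
pose G' := [set xy : d.-tuple R * d.-tuple R |
  B xy.1 /\ A (affine_tuple 1 xy.1 (reflection u xy.2))].
have mR2 : measurable_fun setT (fun xy : d.-tuple R * d.-tuple R => reflection u xy.2).
  exact: measurableT_comp.
have mG : measurable G.
  apply: measurableI; first exact: (measurable_preimageT fst).
  apply: (measurable_preimageT (fun xy => affine_tuple (-1) xy.1 (reflection u xy.2))) => //.
  exact: measurable_affine2.
have mG' : measurable G'.
  apply: measurableI; first exact: (measurable_preimageT fst).
  apply: (measurable_preimageT (fun xy => affine_tuple 1 xy.1 (reflection u xy.2))) => //.
  exact: measurable_affine2.
have E1 : (\int[mu]_x mu [set y | G (x, y)] = mu A * mu B)%E.
  rewrite -integral_indic_mule//; apply: eq_integral => x _.
  case: ifPn => [/set_mem xA|xA]; last first.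
    rewrite (_ : [set y | _] = set0) ?measure0//.
    by apply/seteqP; split => y // -[/mem_set xA' _]; rewrite xA' in xA.
  rewrite -(lebesgue_tuple_translate (reflection u x)); last first.
    exact: (measurable_preimageT (pair x)).
  congr (mu _); apply/funext => y; apply/propext.
  rewrite /G/= reflection_affine reflectionK -[X in _ <-> X]BN -[X in _ <-> X]Bopp.
  rewrite (_ : affine_tuple (-1) x _ = affine_tuple (-1) zero_tuple (reflection u y)).
    by split=> [[]|].
  by apply: eq_from_tnth => i; rewrite !tnth_affine tnth_mktuple; ring.
have E2 : (\int[mu]_x mu [set y | G' (x, y)] = mu B * mu (reflection u @^-1` A))%E.
  rewrite -integral_indic_mule//; apply: eq_integral => x _.
  case: ifPn => [/set_mem xA|xA]; last first.
    rewrite (_ : [set y | _] = set0) ?measure0//.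
    by apply/seteqP; split => y // -[/mem_set xA' _]; rewrite xA' in xA.
  rewrite -[RHS](lebesgue_tuple_translate (reflection u x)); last exact: measurable_preimageT.
  congr (mu _); apply/funext => y; apply/propext; rewrite /G'/= reflection_affine reflectionK.
  by split=> [[]|].
have E3 : (\int[mu]_x mu [set y | G (x, y)] = \int[mu]_x mu [set y | G' (x, y)])%E.
  rewrite lebesgue_tuple_swap// [RHS]lebesgue_tuple_swap//.
  apply: eq_integral => y _.
  rewrite -(lebesgue_tuple_translate (reflection u y)); last first.
    exact: (measurable_preimageT (fun x => (x, y))).
  congr (mu _); apply/funext => x; apply/propext; rewrite /G /G'/=.
  rewrite (_ : affine_tuple (-1) _ _ = x); last first.
    by apply: eq_from_tnth => i; rewrite !tnth_affine; ring.
  rewrite (_ : affine_tuple 1 (reflection u y) x = affine_tuple 1 x (reflection u y)).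
    by split=> -[].
  by apply: eq_from_tnth => i; rewrite !tnth_affine; ring.
have [b b0 Bb] : exists2 b : R, 0 < b & mu B = b%:E.
  exists (fine (mu B)); first by rewrite fine_gt0// B0.
  by rewrite fineK// ge0_fin_numE.
have K (c : \bar R) : (b^-1%:E * (b%:E * c) = c)%E.
  by rewrite muleA -EFinM mulVf ?mul1e// gt_eqF.
by rewrite -[LHS]K -[RHS]K -Bb -E2 -E3 E1 [(mu B * mu A)%E]muleC.
Qed.

End ReflectionInvariance.

(** * The Gaussian integral and the volume of a ball *)

Section GammaIntegrals.
Context {R : realType}.
Local Notation mu := (@lebesgue_measure R).

Lemma integral_if {dT} {T : measurableType dT} (m : {measure set T -> \bar R})
    (b : T -> bool) (f : T -> \bar R) :
  (\int[m]_x (if b x then f x else 0) = \int[m]_(x in [set x | b x]) f x)%E.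
Proof.
rewrite [RHS]integral_mkcond; apply: eq_integral => x _.
by rewrite patchE; congr (if _ then _ else _); apply/idP/idP => [/mem_set|/set_mem].
Qed.

Lemma integral_expRN_tail (a : R) :
  (\int[mu]_(x in `[a, +oo[) (expR (- x))%:E = (expR (- a))%:E)%E.
Proof.
rewrite (@ge0_continuous_FTC2y _ _ (fun x => - expR (- x)) _ 0).
- by rewrite EFinN oppeK add0e.
- by move=> x _; exact: expR_ge0.
- apply: continuous_subspaceT => x; apply: (@continuous_comp _ _ _ -%R expR).
    exact: opp_continuous.
  exact: continuous_expR.
- by rewrite -oppr0; apply: cvgN; exact: cvgr_expR.
- move=> x _; exact: ex_derive.
- apply: cvg_at_right_filter; apply: cvgN; apply: (@continuous_comp _ _ _ -%R expR).
    exact: opp_continuous.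
  exact: continuous_expR.
- move=> x _; rewrite derive1E derive_val; rewrite /GRing.scale/=; ring.
Qed.

Lemma continuous_powR_gt0 (a x : R) : 0 < x ->
  {for x, continuous (fun v : R => v `^ a)}.
Proof.
move=> x0; apply: differentiable_continuous; apply/derivable1_diffP.
by have [] := is_derive1_powR a x0.
Qed.

(** The integrand may be unbounded at 0 when a < 1, so the fundamental
    theorem of calculus is applied on [u / n, u] before passing to the limit. *)
Lemma integral_powR (a u : R) : 0 < a -> 0 < u ->
  (\int[mu]_(v in `]0%R, u]) (a * v `^ (a - 1))%:E = (u `^ a)%:E)%E.
Proof.
move=> a0 u0.
pose F (n : nat) := `[u * n.+2%:R^-1, u]%classic : set (measurableTypeR R).
have Fpos n : 0 < u * n.+2%:R^-1 by rewrite divr_gt0.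
have Flt n : u * n.+2%:R^-1 < u by rewrite ltr_pdivrMr// ltr_pMr// ltr1n.
have EF : `]0, u]%classic = \bigcup_n F n.
  apply/seteqP; split => x /=; rewrite ?in_itv/=.
    move=> /andP[x0 xu].
    have [n nx] := @ltr_add_invr R 0 (x / u) (divr_gt0 x0 u0).
    exists n => //; rewrite /F/= in_itv/= xu andbT mulrC -ler_pdivlMr//.
    rewrite add0r in nx; apply: le_trans (ltW nx).
    by rewrite lef_pV2 ?posrE// ler_nat.
  by move=> [n _]; rewrite /F/= in_itv/= => /andP[nx ->]; rewrite andbT (lt_le_trans _ nx).
rewrite EF.
have contG n : {within F n : set R, continuous (fun v : R => a * v `^ (a - 1))}.
  apply: continuous_in_subspaceT => x; rewrite inE /F/= in_itv/= => /andP[nx _].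
  apply: cvgM; first exact: cvg_cst.
  by apply: continuous_powR_gt0; exact: lt_le_trans nx.
have E n : (\int[mu]_(v in F n) (a * v `^ (a - 1))%:E =
    (u `^ a - (u * n.+2%:R^-1) `^ a)%:E)%E.
  rewrite (@continuous_FTC2 _ _ (fun v => v `^ a))//.
  - exact: contG.
  - split.
    + move=> x; rewrite in_itv/= => /andP[nx xu].
      by have [] := is_derive1_powR a (lt_trans (Fpos n) nx).
    + by apply: cvg_at_right_filter; exact: continuous_powR_gt0.
    + by apply: cvg_at_left_filter; exact: continuous_powR_gt0.
  - move=> x; rewrite in_itv/= => /andP[nx xu].
    by rewrite derive1E; have [_ ->] := is_derive1_powR a (lt_trans (Fpos n) nx).
have h := @ge0_nondecreasing_set_cvg_integral _ _ R F (fun v => (a * v `^ (a - 1))%:E) mu.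
apply: cvg_unique (h _ _ _ _) _ => //.
- apply/nondecreasing_seqP => n; rewrite subsetEset => x; rewrite /F/= !in_itv/=.
  move=> /andP[nx ->]; rewrite andbT (le_trans _ nx)// ler_wpM2l ?ltW//.
  by rewrite ltf_pV2 ?posrE// ltr_nat.
- by move=> i; exact: measurable_itv.
- move=> i; apply/measurable_EFinP; apply: measurable_funM => //.
  exact: measurable_funTS (measurable_powR (a - 1)).
- by move=> i x _; rewrite lee_fin mulr_ge0 ?powR_ge0// ltW.
- rewrite /=; under eq_fun do rewrite E.
  apply: cvg_EFin; first by near=> n.
  rewrite -[X in _ --> X]subr0; apply: cvgB; first exact: cvg_cst.
  have /cvg_at_rightP := powR_cvg0 a0; apply; split => //.
  rewrite -(mulr0 u); apply: cvgM; first exact: cvg_cst.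
  have := @cvg_harmonic R; rewrite -(cvg_shiftS (fun n => n.+1%:R^-1 : R)).
  exact.
Unshelve. all: by end_near. Qed.

(** The recursion Gamma (a + 1) = a Gamma a, obtained by writing u^a as the
    integral of a v^(a - 1) over v < u and exchanging the two integrals. *)
Lemma gamma_integral_rec (a : R) : 0 < a ->
  (\int[mu]_(u in `]0%R, +oo[) (u `^ a * expR (- u))%:E =
   a%:E * \int[mu]_(v in `]0%R, +oo[) (v `^ (a - 1) * expR (- v))%:E)%E.
Proof.
move=> a0.
pose f (z : measurableTypeR R * measurableTypeR R) : \bar R :=
  if (0 < z.2) && (z.2 <= z.1) then (a * z.2 `^ (a - 1) * expR (- z.1))%:E else 0%E.
have f0 z : (0 <= f z)%E.
  by rewrite /f; case: ifP => // _; rewrite lee_fin !mulr_ge0 ?expR_ge0 ?powR_ge0// ltW.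
have mf : measurable_fun setT f.
  apply: measurable_fun_ifT => //.
    apply: measurable_and; first exact: measurable_fun_ltr.
    exact: measurable_fun_ler.
  apply/measurable_EFinP; apply: measurable_funM.
    apply: measurable_funM => //; apply: (measurableT_comp (measurable_powR _)).
    exact: measurable_snd.
  apply: (measurableT_comp (@measurable_expR R)); exact: measurable_funN.
have e0y : `]0, +oo[%classic = [set u : R | 0 < u].
  by apply/seteqP; split => u /=; rewrite in_itv/= andbT.
transitivity (\int[mu]_u \int[mu]_v f (u, v))%E.
  rewrite e0y -integral_if; apply: eq_integral => u _; rewrite integral_if/=.
  have -> : [set v : measurableTypeR R | (0 < v) && (v <= u)] = `]0, u]%classic.
    by apply/seteqP; split => v /=; rewrite in_itv.
  case: ifPn => [u0|u0]; last first.
    by rewrite set_itv_ge ?integral_set0// bnd_simp.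
  under eq_integral do rewrite EFinM.
  rewrite ge0_integralZr//; last 2 first.
  - apply/measurable_EFinP; apply: measurable_funM => //.
    exact: measurable_funTS (measurable_powR (a - 1)).
  - by move=> v _; rewrite lee_fin mulr_ge0 ?powR_ge0// ltW.
  by rewrite integral_powR// EFinM.
rewrite fubini_tonelli// e0y -[X in (_ * X)%E]integral_if -ge0_integralZl//; last 3 first.
- apply: measurable_fun_ifT => //; first exact: measurable_fun_ltr.
  apply/measurable_EFinP; apply: measurable_funM; first exact: measurable_powR.
  by apply: (measurableT_comp (@measurable_expR R)); exact: measurable_funN.
- by move=> v _; case: ifP => // _; rewrite lee_fin mulr_ge0 ?powR_ge0 ?expR_ge0.
- by rewrite lee_fin ltW.
apply: eq_integral => v _; rewrite /f/=.
case: ifP => v0 /=; last by rewrite integral0// mule0.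
rewrite integral_if.
have -> : [set u : measurableTypeR R | v <= u] = `[v, +oo[%classic.
  by apply/seteqP; split => u /=; rewrite in_itv/= andbT.
under eq_integral do rewrite EFinM.
rewrite ge0_integralZl//.
- by rewrite integral_expRN_tail -!EFinM mulrA.
- by apply/measurable_EFinP; apply: (measurableT_comp (@measurable_expR R)); exact: measurable_funN.
- by rewrite lee_fin mulr_ge0 ?powR_ge0// ltW.
Qed.

End GammaIntegrals.

Section BallVolume.
Context {R : realType} {d : nat}.
Local Notation mu := (@lebesgue_measure R).

Lemma lebesgue_tuple_origin_ball (r : R) : 0 < r ->
  lebesgue_tuple d (origin_ball r) = ((r ^+ d)%:E * lebesgue_tuple d (origin_ball 1))%E.
Proof.
move=> r0.
have <- : affine_tuple r^-1 zero_tuple @^-1` origin_ball 1 = @origin_ball R d r.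
  have ir0 : 0 <= r^-1 by rewrite invr_ge0 ltW.
  apply/funext => x; rewrite /origin_ball/= enorm_scale//.
  by rewrite mulrC ler_pdivrMr// mul1r.
rewrite lebesgue_tuple_affine ?invr_gt0// ?invrK//.
exact: measurable_origin_ball.
Qed.

End BallVolume.

Section GaussianBall.
Context {R : realType}.
Local Notation mu := (@lebesgue_measure R).

Lemma measurable_gauss_tuple (d : nat) :
  measurable_fun setT (fun x : d.-tuple R => (expR (- dot x x))%:E).
Proof.
apply/measurable_EFinP; apply: (measurableT_comp (@measurable_expR R)).
by apply: measurable_funN; exact: measurable_dot.
Qed.

Lemma integral_gauss_tuple (d : nat) :
  (\int[lebesgue_tuple d]_x (expR (- dot x x))%:E = (Num.sqrt pi ^+ d)%:E :> \bar R)%E.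
Proof.
elim: d => [|d IH].
  rewrite integral_dirac//; last exact: measurable_gauss_tuple.
  by rewrite /dot big_ord0 oppr0 expR0 diracT mul1e.
rewrite ge0_integral_lebesgue_tupleS; last 2 first.
- exact: measurable_gauss_tuple.
- by move=> x; rewrite lee_fin expR_ge0.
transitivity (\int[mu]_x ((gauss_fun x)%:E * (Num.sqrt pi ^+ d)%:E))%E.
  apply: eq_integral => x _; rewrite -IH -ge0_integralZl//; last 2 first.
  - exact: measurable_gauss_tuple.
  - by rewrite lee_fin gauss_fun_ge0.
  apply: eq_integral => y _; rewrite -EFinM; congr EFin.
  rewrite /gauss_fun -expRD; congr expR.
  rewrite {1}/dot big_ord_recl !tnth0 opprD expr2; congr (_ - _).
  by apply: eq_bigr => i _; rewrite !tnthS.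
rewrite ge0_integralZr//; last 2 first.
- by apply/measurable_EFinP; exact: measurable_gauss_fun.
- by move=> x _; rewrite lee_fin gauss_fun_ge0.
by rewrite integralT_gauss -EFinM exprS.
Qed.

(** The Gaussian integral over R^d is computed layer by layer: exp (- |x|^2)
    is the integral of exp (- u) over u > |x|^2, and the points with |x|^2 <= u
    form a ball of volume u^(d/2) times that of the unit ball. *)
Lemma ball_volume_gamma_integral (d : nat) :
  ((Num.sqrt pi ^+ d)%:E =
   lebesgue_tuple d (origin_ball 1) *
   \int[mu]_(u in `]0%R, +oo[) (u `^ (d%:R / 2) * expR (- u))%:E :> \bar R)%E.
Proof.
rewrite -integral_gauss_tuple.
pose f (z : d.-tuple R * measurableTypeR R) : \bar R :=
  if (0 < z.2) && (dot z.1 z.1 <= z.2) then (expR (- z.2))%:E else 0%E.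
have f0 z : (0 <= f z)%E by rewrite /f; case: ifP => // _; rewrite lee_fin expR_ge0.
have mf : measurable_fun setT f.
  apply: measurable_fun_ifT => //.
    apply: measurable_and; first exact: measurable_fun_ltr.
    apply: measurable_fun_ler => //; exact: measurable_dot.
  apply/measurable_EFinP; apply: (measurableT_comp (@measurable_expR R)); exact: measurable_funN.
have e0y : `]0, +oo[%classic = [set u : R | 0 < u].
  by apply/seteqP; split => u /=; rewrite in_itv/= andbT.
transitivity (\int[lebesgue_tuple d]_x \int[mu]_u f (x, u))%E.
  apply: eq_integral => x _; rewrite /f/= integral_if -integral_expRN_tail.
  have := dot_ge0 x; rewrite le_eqVlt => /orP[/eqP <-|x0].
    rewrite -[LHS]integral_itv_obnd_cbnd; last first.
      apply/measurable_EFinP; apply: (measurableT_comp (@measurable_expR R)).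
      exact: measurable_funN.
    congr (integral _ _ _); apply/seteqP; split => u /=; rewrite in_itv/= andbT.
      by move=> u0; rewrite u0 ltW.
    by move=> /andP[].
  congr (integral _ _ _); apply/seteqP; split => u /=; rewrite in_itv/= andbT.
    by move=> xu; rewrite xu andbT (lt_le_trans x0).
  by move=> /andP[].
rewrite fubini_tonelli// e0y -[X in (_ * X)%E]integral_if -ge0_integralZl//; last 2 first.
- apply: measurable_fun_ifT => //; first exact: measurable_fun_ltr.
  apply/measurable_EFinP; apply: measurable_funM; first exact: measurable_powR.
  by apply: (measurableT_comp (@measurable_expR R)); exact: measurable_funN.
- by move=> v _; case: ifP => // _; rewrite lee_fin mulr_ge0 ?powR_ge0 ?expR_ge0.
apply: eq_integral => u _; rewrite /f/=.
case: ifP => u0 /=; last by rewrite integral0// mule0.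
rewrite integral_if integral_cst; last first.
  rewrite (_ : [set x | _] = (fun x => dot x x) @^-1` `]-oo, u]%classic).
    apply: measurable_preimageT => //; exact: measurable_dot.
  by apply/seteqP; split => x /=; rewrite in_itv.
have su0 : 0 < Num.sqrt u by rewrite sqrtr_gt0.
have -> : [set x : d.-tuple R | dot x x <= u] = origin_ball (Num.sqrt u).
  apply/seteqP; split => x; rewrite /origin_ball/= enorm_le ?(ltW su0)//.
    by rewrite sqr_sqrtr// ltW.
  by rewrite sqr_sqrtr// ltW.
rewrite [X in (_ * X)%E = _](lebesgue_tuple_origin_ball _ su0) muleA muleC -EFinM.
congr (_ * _%:E)%E; rewrite mulrC; congr (_ * _).
by rewrite -powR12_sqrt ?(ltW u0)// -powR_mulrn ?powR_ge0// -powRrM mulrC.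
Qed.

End GaussianBall.

(** * The volume of a spherical sector *)

Section BallVolumeGamma.
Context {R : realType}.
Local Notation mu := (@lebesgue_measure R).

Definition ball_volume (d : nat) : R := fine (@lebesgue_tuple R d (origin_ball 1)).

(** Besides the value of the volume of the ball, the identity between extended
    reals shows at once that both factors are finite and positive, because
    their product is. *)
Lemma ball_volume_gamma (d : nat) : (0 < d)%N ->
  [/\ @lebesgue_tuple R d (origin_ball 1) = (ball_volume d)%:E,
      0 < ball_volume d, 0 < Gamma (d%:R / 2 : R) &
      Num.sqrt pi ^+ d = ball_volume d * (d%:R / 2 * Gamma (d%:R / 2))].
Proof.
move=> d0; have a0 : 0 < d%:R / 2 :> R by rewrite divr_gt0 ?ltr0n.
have := @ball_volume_gamma_integral R d; rewrite gamma_integral_rec//.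
have -> : Gamma (d%:R / 2 : R) =
  fine (\int[mu]_(v in `]0%R, +oo[) (v `^ (d%:R / 2 - 1) * expR (- v))%:E) by [].
set G := (\int[mu]_(v in _) _)%E.
have G0 : (0 <= G)%E.
  by apply: integral_ge0 => v _; rewrite lee_fin mulr_ge0 ?powR_ge0 ?expR_ge0.
rewrite /ball_volume; set B := lebesgue_tuple d _.
have B0 : (0 <= B)%E by exact: measure_ge0.
have pi0 : 0 < Num.sqrt pi ^+ d :> R by rewrite exprn_gt0// sqrtr_gt0 pi_gt0.
case: G G0 => [g| |]// G0; case: B B0 => [b| |]// B0.
- rewrite -!EFinM => -[E]; rewrite !lee_fin in G0 B0.
  have /= : 0 < b * (d%:R / 2 * g) by rewrite -E.
  rewrite /= E => P; split => //.
    by rewrite lt_neqAle B0 andbT; apply: contraTN P => /eqP <-; rewrite mul0r ltxx.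
  by rewrite lt_neqAle G0 andbT; apply: contraTN P => /eqP <-; rewrite !mulr0 ltxx.
- rewrite -EFinM; rewrite !lee_fin in G0 B0.
  have [->|g0] := eqVneq g 0; first by rewrite mulr0 mule0 => -[E]; rewrite E ltxx in pi0.
  by rewrite mulyr gtr0_sg ?mul1e// mulr_gt0// lt_neqAle eq_sym g0 G0.
- rewrite lee_fin in B0; rewrite mulry gtr0_sg// mul1e.
  have [->|b0] := eqVneq b 0; first by rewrite mul0e => -[E]; rewrite E ltxx in pi0.
  by rewrite mulry gtr0_sg ?mul1e// lt_neqAle eq_sym b0.
- by rewrite mulry gtr0_sg// mul1e mulyy.
Qed.

Lemma lebesgue_tuple_origin_ballE (d : nat) (r : R) : (0 < d)%N -> 0 < r ->
  @lebesgue_tuple R d (origin_ball r) = (r ^+ d * ball_volume d)%:E.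
Proof.
move=> d0 r0; have [Bv _ _ _] := ball_volume_gamma d d0.
by rewrite EFinM -Bv; exact: lebesgue_tuple_origin_ball.
Qed.

Lemma ball_volume_ratio (d : nat) : (1 < d)%N ->
  ball_volume d.-1 / (d%:R * ball_volume d) =
  Gamma (d%:R / 2) / ((d%:R - 1) * pi `^ (1 / 2) * Gamma ((d%:R - 1) / 2)).
Proof.
case: d => // d /= d1.
have [_ B0 G0 E] := ball_volume_gamma d.+1 isT.
have [_ B0' G0' E'] := ball_volume_gamma d d1.
rewrite mul1r powR12_sqrt ?pi_ge0// -natr1 addrK.
have d0 : d%:R != 0 :> R by rewrite pnatr_eq0 -lt0n.
have d10 : d%:R + 1 != 0 :> R by rewrite natr1 pnatr_eq0.
rewrite natr1 in d10 *.
have p0 : Num.sqrt pi != 0 :> R by rewrite sqrtr_eq0 -ltNge pi_gt0.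
have pd0 : Num.sqrt pi ^+ d != 0 :> R by rewrite expf_neq0.
set g := Gamma _ in G0 E *; set g' := Gamma _ in G0' E' *.
have -> : ball_volume d = Num.sqrt pi ^+ d / (d%:R / 2 * g').
  by rewrite E' mulfK// mulf_neq0 ?(gt_eqF G0')// mulf_neq0 ?invr_eq0.
have -> : ball_volume d.+1 = Num.sqrt pi ^+ d.+1 / (d.+1%:R / 2 * g).
  by rewrite E mulfK// mulf_neq0 ?(gt_eqF G0)// mulf_neq0 ?invr_eq0.
rewrite exprS; field.
by rewrite nat1r d0 d10 p0 pd0 (gt_eqF G0) (gt_eqF G0').
Qed.

End BallVolumeGamma.

Section CapCone.
Context {R : realType} {d : nat}.
Hypothesis d_gt0 : (0 < d)%N.
Local Notation mu := (@lebesgue_measure R).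

(** The solid sector over the spherical cap around x whose angle has cosine q.
    The origin is left out, as in the cones that define the surface measure. *)
Definition cap_cone {m : nat} (x : m.-tuple R) (q : R) : set (m.-tuple R) :=
  [set y | 0 < enorm y <= 1 /\ q * enorm y <= dot x y].

Lemma measurable_cap_cone {m : nat} (x : m.-tuple R) q : measurable (cap_cone x q).
Proof.
have b1 : measurable_fun setT (fun y : m.-tuple R =>
    ((0 < enorm y) && (enorm y <= 1)) && (q * enorm y <= dot x y)).
  apply: measurable_and; first apply: measurable_and.
  - apply: measurable_fun_ltr => //; exact: measurable_enorm.
  - apply: measurable_fun_ler => //; exact: measurable_enorm.
  - apply: measurable_fun_ler; last exact: measurable_dot.
    by apply: measurable_funM => //; exact: measurable_enorm.
rewrite (_ : cap_cone x q = (fun y : m.-tuple R =>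
  ((0 < enorm y) && (enorm y <= 1)) && (q * enorm y <= dot x y)) @^-1` [set true]).
  exact: measurable_preimageT.
by apply/seteqP; split => y; rewrite /cap_cone/= => /andP.
Qed.

Lemma cap_cone_reflection {m : nat} (x z : m.-tuple R) q :
  (0 < m)%N -> dot x x = dot z z ->
  lebesgue_tuple m (cap_cone x q) = lebesgue_tuple m (cap_cone z q).
Proof.
move=> m0 xz; have [Bv B0 _ _] := @ball_volume_gamma R m m0.
rewrite -(@lebesgue_tuple_reflection R m (affine_tuple (-1) x z)); last 2 first.
- exact: measurable_cap_cone.
- by rewrite [X in (0 < X < _)%E]Bv lte_fin B0 ltry.
congr (lebesgue_tuple m _); apply/funext => y; rewrite /cap_cone/=.
rewrite !enormE reflection_dot.
by rewrite -(reflection_dot (affine_tuple (-1) x z) x) reflectionK reflection_swap.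
Qed.

Definition pole : d.+1.-tuple R := cons_pair (1, zero_tuple).

Lemma dot_cons (h k : R) (v w : d.-tuple R) :
  dot (cons_pair (h, v)) (cons_pair (k, w)) = h * k + dot v w.
Proof.
rewrite /dot big_ord_recl !tnth0; congr (_ + _).
by apply: eq_bigr => i _; rewrite !tnthS.
Qed.

Variable q : R.
Hypothesis q01 : 0 < q < 1.
Let tau := Num.sqrt (1 - q ^+ 2) / q.

Let q0 : 0 < q. Proof. by have /andP[] := q01. Qed.
Let q1 : q < 1. Proof. by have /andP[] := q01. Qed.
Let q2_lt1 : q ^+ 2 < 1. Proof. by rewrite expr_lt1// ltW. Qed.
Let tau0 : 0 < tau.
Proof. by rewrite divr_gt0// sqrtr_gt0 subr_gt0. Qed.
Let tau2 : tau ^+ 2 = (1 - q ^+ 2) / q ^+ 2.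
Proof. by rewrite expr_div_n sqr_sqrtr// subr_ge0 ltW. Qed.

Let cap_coneE (h : R) (w : d.-tuple R) : 0 < h ->
  (q * enorm (cons_pair (h, w)) <= h) = (enorm w <= h * tau).
Proof.
move=> h0; have hq0 : 0 <= h / q by rewrite divr_ge0 ?ltW.
have ht0 : 0 <= h * tau by rewrite mulr_ge0 ?ltW.
rewrite mulrC -ler_pdivlMr// !enorm_le//.
rewrite dot_cons -lerBrDl [in RHS]exprMn tau2; congr (_ <= _); field; exact: lt0r_neq0.
Qed.

Lemma integral_slice (u : R) : 0 < u ->
  (\int[mu]_(h in `]0%R, u]) lebesgue_tuple d (origin_ball (h * tau)) =
  (u ^+ d.+1 * (tau ^+ d * ball_volume d / d.+1%:R))%:E)%E.
Proof.
move=> u0; have [Bv B0 _ _] := @ball_volume_gamma R d d_gt0.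
transitivity (\int[mu]_(h in `]0%R, u])
   ((d.+1%:R * h `^ (d.+1%:R - 1))%:E * (tau ^+ d * ball_volume d / d.+1%:R)%:E))%E.
  apply: eq_integral => h; rewrite inE/= in_itv/= => /andP[h0 _].
  have ht : 0 < h * tau by exact: mulr_gt0.
  rewrite (lebesgue_tuple_origin_ballE _ _ d_gt0 ht) -EFinM; congr EFin.
  rewrite -natr1 addrK natr1 powR_mulrn ?ltW// exprMn.
  by field; rewrite nat1r pnatr_eq0.
have dd0 : 0 < d.+1%:R :> R by rewrite ltr0n.
rewrite ge0_integralZr//.
- by rewrite (integral_powR _ _ dd0 u0) powR_mulrn ?ltW// -EFinM.
- apply/measurable_EFinP; apply: measurable_funM => //.
  exact: measurable_funTS (measurable_powR _).
- by move=> h _; rewrite lee_fin mulr_ge0 ?powR_ge0.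
- by rewrite lee_fin !(mulr_ge0, invr_ge0, exprn_ge0)// ltW.
Qed.

(** The cone of height u around the first axis with the same opening angle as
    cap_cone pole q: tau is the tangent of that angle. Unlike the spherical
    sector it has a simple volume, and the sector lies between the straight
    cones of heights q and 1. *)
Definition straight_cone (u : R) : set (d.+1.-tuple R) :=
  [set y | 0 < tnth y ord0 <= u /\ enorm [tuple of behead y] <= tnth y ord0 * tau].

Let straight_cone_cons (u h : R) (w : d.-tuple R) :
  straight_cone u (cons_pair (h, w)) <-> 0 < h <= u /\ origin_ball (h * tau) w.
Proof.
have E : enorm [tuple of behead (cons_pair (h, w))] = enorm w.
  by congr (enorm _); apply/val_inj.
by rewrite /straight_cone /mkset E tnth0.
Qed.

Lemma measurable_straight_cone (u : R) : measurable (straight_cone u).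
Proof.
have b1 : measurable_fun setT (fun y : d.+1.-tuple R =>
    ((0 < tnth y ord0) && (tnth y ord0 <= u)) &&
    (enorm [tuple of behead y] <= tnth y ord0 * tau)).
  have m0 : measurable_fun setT (fun y : d.+1.-tuple R => tnth y ord0).
    exact: measurable_tnth.
  apply: measurable_and; first apply: measurable_and.
  - exact: measurable_fun_ltr.
  - exact: measurable_fun_ler.
  - apply: measurable_fun_ler; last exact: measurable_funM.
    by apply: (measurableT_comp (@measurable_enorm R d)); exact: measurable_behead.
rewrite (_ : straight_cone u = (fun y : d.+1.-tuple R =>
    ((0 < tnth y ord0) && (tnth y ord0 <= u)) &&
    (enorm [tuple of behead y] <= tnth y ord0 * tau)) @^-1` [set true]).
  exact: measurable_preimageT.
by apply/seteqP; split => y; rewrite /straight_cone/= => /andP.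
Qed.

Lemma straight_cone_volume (u : R) : 0 < u ->
  lebesgue_tuple d.+1 (straight_cone u) =
  (u ^+ d.+1 * (tau ^+ d * ball_volume d / d.+1%:R))%:E.
Proof.
move=> u0; rewrite lebesgue_tupleS; last exact: measurable_straight_cone.
rewrite -integral_slice// [RHS]integral_mkcond; apply: eq_integral => h _.
rewrite patchE; case: ifPn => [/set_mem/=|/negP hN].
  rewrite in_itv/= => hu; congr (lebesgue_tuple d _); apply/funext => w.
  by apply/propext; split => [/straight_cone_cons[]|hw]//; apply/straight_cone_cons.
rewrite (_ : [set y | _] = set0) ?measure0//; apply/seteqP; split => w //.
move=> /straight_cone_cons[hu _]; apply: hN; apply/mem_set.
by rewrite /= in_itv.
Qed.

Let tuple_consE (y : d.+1.-tuple R) :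
  exists h w, y = cons_pair (h, w).
Proof.
exists (thead y), [tuple of behead y]; rewrite {1}[y]tuple_eta.
exact/val_inj.
Qed.

Let dot_pole h (w : d.-tuple R) : dot pole (cons_pair (h, w)) = h.
Proof. by rewrite dot_cons dot0 addr0 mul1r. Qed.

Let le_enorm_cons h (w : d.-tuple R) : 0 <= h -> h <= enorm (cons_pair (h, w)).
Proof.
move=> h0; rewrite -(@ler_pXn2r _ 2)// ?nnegrE ?enorm_ge0// sqr_enorm dot_cons -expr2.
by rewrite lerDl dot_ge0.
Qed.

Lemma cap_cone_pole_le :
  (lebesgue_tuple d.+1 (cap_cone pole q) <=
   (tau ^+ d * ball_volume d / d.+1%:R)%:E)%E.
Proof.
have := straight_cone_volume 1 ltr01; rewrite expr1n mul1r => <-.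
apply: le_measure; rewrite ?inE.
- exact: measurable_cap_cone.
- exact: measurable_straight_cone.
move=> y; have [h [w ->]] := tuple_consE y.
rewrite /cap_cone/= dot_pole => -[/andP[n0 n1] hn].
have h0 : 0 < h by apply: lt_le_trans hn; rewrite mulr_gt0.
apply/straight_cone_cons; split; last by rewrite /origin_ball/= -cap_coneE.
by rewrite h0 (le_trans _ n1)// le_enorm_cons// ltW.
Qed.

Lemma cap_cone_pole_ge :
  ((q ^+ d.+1 * (tau ^+ d * ball_volume d / d.+1%:R))%:E <=
   lebesgue_tuple d.+1 (cap_cone pole q))%E.
Proof.
rewrite -straight_cone_volume//.
apply: le_measure; rewrite ?inE.
- exact: measurable_straight_cone.
- exact: measurable_cap_cone.
move=> y; have [h [w ->]] := tuple_consE y.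
move=> /straight_cone_cons[/andP[h0 hq]]; rewrite /origin_ball/= -cap_coneE// => hn.
rewrite /cap_cone/= dot_pole; split => //.
rewrite (lt_le_trans h0 (le_enorm_cons _ _ (ltW h0)))/=.
by rewrite -(ler_pM2l q0) mulr1 (le_trans hn).
Qed.

End CapCone.

(** * The uniform probability on the sphere *)

Section FiniteLabels.
Context {dT} {T : measurableType dT} {R : realType} {I : finType}.
Variables (m : {measure set T -> \bar R}) (c : T -> I).
Hypothesis mc : forall i, measurable (c @^-1` [set i]).

Lemma measurable_label (J : pred I) : measurable [set x | J (c x)].
Proof.
rewrite (_ : [set x | _] = \bigcup_(i in [set i | J i]) (c @^-1` [set i])).
  by apply: fin_bigcup_measurable => // i _; exact: mc.
by apply/seteqP; split => [x Jx|x [i /= Ji ->//]]; exists (c x).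
Qed.

Lemma measure_label (J : pred I) :
  m [set x | J (c x)] = (\sum_(i | J i) m (c @^-1` [set i]))%E.
Proof.
rewrite -big_enum/=.
have -> : [set x | J (c x)] = [set x | c x \in enum J].
  by apply/seteqP; split => x /=; rewrite mem_enum.
elim: (enum J) (enum_uniq J) => [_|i s IH /= /andP[si us]].
  by rewrite big_nil (_ : [set x | _] = set0) ?measure0//; apply/seteqP; split.
rewrite big_cons -IH// (_ : [set x | _] = c @^-1` [set i] `|` [set x | c x \in s]).
  rewrite measureU//; first exact: (measurable_label (mem s)).
  by apply/seteqP; split => // x [/= -> si']; rewrite si' in si.
apply/seteqP; split => x /=; rewrite inE; first by move=> /orP[/eqP|]; [left|right].
by move=> [->|->]; rewrite ?eqxx ?orbT.
Qed.

End FiniteLabels.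

Section SphereMeasure.
Context {R : realType} {d : nat}.
Hypothesis d_gt0 : (0 < d)%N.
Implicit Types (x y : d.-tuple R) (A B : set (d.-tuple R)).

Definition normalize y : d.-tuple R := affine_tuple (enorm y)^-1 zero_tuple y.

Lemma enorm_normalize y : 0 < enorm y -> enorm (normalize y) = 1.
Proof.
by move=> y0; rewrite enorm_scale ?invr_ge0 ?ltW// mulVf// gt_eqF.
Qed.

Lemma measurable_normalize : measurable_fun setT normalize.
Proof.
apply: measurable_affine2 => //.
rewrite (_ : (fun _ => _) = (fun r : R => r `^ (-1)) \o @enorm R d).
  by apply: measurableT_comp; [exact: measurable_powR|exact: measurable_enorm].
by apply/funext => y /=; rewrite powR_inv1// enorm_ge0.
Qed.

Definition punctured_ball : set (d.-tuple R) := [set y | 0 < enorm y <= 1].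

Lemma measurable_punctured_ball : measurable punctured_ball.
Proof.
rewrite (_ : punctured_ball = (@enorm R d) @^-1` `]0, 1]%classic).
  by apply: measurable_preimageT => //; exact: measurable_enorm.
by apply/seteqP; split => y /=; rewrite in_itv.
Qed.

(** The cone spanned by the part of A on the unit sphere, presented as a
    preimage so that measurability and additivity are immediate. *)
Definition cone_over A : set (d.-tuple R) := normalize @^-1` A `&` punctured_ball.

Lemma measurable_cone_over A : measurable A -> measurable (cone_over A).
Proof.
move=> mA; apply: measurableI; last exact: measurable_punctured_ball.
by apply: measurable_preimageT => //; exact: measurable_normalize.
Qed.

Lemma cone_sphereE A : cone (A `&` unit_sphere R d) = cone_over A.
Proof.
have scaleE r x : [tuple r * tnth x i | i < d] = affine_tuple r zero_tuple x.
  by apply: eq_from_tnth => i; rewrite tnth_affine !tnth_mktuple addr0.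
apply/seteqP; split => y.
  move=> [r [x [/andP[r0 r1] [Ax Sx] ->]]]; rewrite scaleE.
  have nE : enorm (affine_tuple r zero_tuple x) = r.
    by rewrite enorm_scale ?ltW// Sx mulr1.
  split; last by rewrite /punctured_ball/= nE r0.
  rewrite /normalize/= nE (_ : affine_tuple r^-1 _ _ = x)//.
  apply: eq_from_tnth => i; rewrite !tnth_affine !tnth_mktuple !addr0.
  by rewrite mulKf// gt_eqF.
move=> [Ay /andP[y0 y1]]; exists (enorm y), (normalize y); split => //.
- by rewrite y0.
- by split => //; rewrite /unit_sphere/= enorm_normalize.
rewrite scaleE; apply: eq_from_tnth => i; rewrite !tnth_affine !tnth_mktuple !addr0.
by rewrite mulVKf// gt_eqF.
Qed.

(** The origin has measure zero, since doubling it changes nothing but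
    multiplies its volume by 2^d. *)
Lemma punctured_ball_volume : lebesgue_tuple d punctured_ball = (@ball_volume R d)%:E.
Proof.
have [Bv B0 _ _] := @ball_volume_gamma R d d_gt0.
have mP := measurable_punctured_ball.
have m0 : measurable [set y : d.-tuple R | enorm y <= 0] by exact: measurable_origin_ball.
have z0 : lebesgue_tuple d [set y : d.-tuple R | enorm y <= 0] = 0%E.
  have E : [set y : d.-tuple R | enorm y <= 0] =
      affine_tuple 2^-1 zero_tuple @^-1` [set y | enorm y <= 0].
    by apply/funext => y /=; rewrite enorm_scale// pmulr_rle0.
  have h2 : 0 < 2^-1 :> R by rewrite invr_gt0.
  have := lebesgue_tuple_affine d 2^-1 zero_tuple _ h2 m0.
  rewrite -E invrK; set z := lebesgue_tuple d _.
  have zfin : z \is a fin_num.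
    rewrite ge0_fin_numE ?measure_ge0//.
    apply: (@le_lt_trans _ _ (lebesgue_tuple d (origin_ball 1))).
      apply: le_measure; rewrite ?inE//; first exact: measurable_origin_ball.
      by move=> y /= /le_trans; apply.
    by rewrite [X in (X < _)%E]Bv ltry.
  rewrite -(fineK zfin) -EFinM => -[] /eqP; rewrite eq_sym -subr_eq0 -{2}[fine z]mul1r -mulrBl.
  rewrite mulf_eq0 => /orP[|/eqP->//]; rewrite subr_eq0 => /eqP h.
  have : 1 < (2 : R) ^+ d by rewrite exprn_egt1// ?ltr1n// -lt0n.
  by rewrite h ltxx.
rewrite -Bv (_ : origin_ball 1 = punctured_ball `|` [set y | enorm y <= 0]).
  rewrite measureU//; first by rewrite [X in (_ + X)%E]z0 adde0.
  by apply/seteqP; split => // y [/= /andP[y0 _]]; rewrite leNgt y0.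
apply/seteqP; split => y; rewrite /origin_ball /punctured_ball/=.
  by move=> ->; rewrite andbT; have [|] := ltP 0 (enorm y); [left|right].
by move=> [/andP[]//|/le_trans]; apply.
Qed.

Definition sphere_measure : set (d.-tuple R) -> \bar R :=
  fun A => lebesgue_tuple d (cone_over A).

Let sphere_measure0 : sphere_measure set0 = 0%E.
Proof. by rewrite /sphere_measure /cone_over preimage_set0 set0I measure0. Qed.

Let sphere_measure_ge0 A : (0 <= sphere_measure A)%E.
Proof. exact: measure_ge0. Qed.

Let sphere_measure_sigma_additive : semi_sigma_additive sphere_measure.
Proof.
move=> F mF tF mUF; rewrite /sphere_measure.
rewrite (_ : cone_over (\bigcup_n F n) = \bigcup_n cone_over (F n)); last first.
  by rewrite /cone_over preimage_bigcup setI_bigcupl.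
apply: measure_semi_sigma_additive.
- by move=> i; exact: measurable_cone_over.
- apply/trivIsetP => i j _ _ ij; rewrite /cone_over setIACA -preimage_setI.
  by move/trivIsetP : tF => /(_ i j Logic.I Logic.I ij) ->; rewrite preimage_set0 set0I.
- by apply: bigcup_measurable => i _; exact: measurable_cone_over.
Qed.

HB.instance Definition _ := isMeasure.Build _ _ _ sphere_measure
  sphere_measure0 sphere_measure_ge0 sphere_measure_sigma_additive.

(** The uniform probability on the sphere: the total mass of sphere_measure is
    the volume of the unit ball, by punctured_ball_volume. *)
Definition sphere_prob A : R := fine (sphere_measure A) / ball_volume d.

Lemma sphere_measure_le A : measurable A -> (sphere_measure A <= (@ball_volume R d)%:E)%E.
Proof.
move=> mA; rewrite -punctured_ball_volume; apply: le_measure; rewrite ?inE.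
- exact: measurable_cone_over.
- exact: measurable_punctured_ball.
- by move=> y [].
Qed.

Lemma sphere_measure_fin A : measurable A -> sphere_measure A \is a fin_num.
Proof.
move=> mA; rewrite ge0_fin_numE//.
by apply: le_lt_trans (sphere_measure_le _ mA) _; rewrite ltry.
Qed.

Let kappa_gt0 : 0 < @ball_volume R d.
Proof. by have [_ ? _ _] := @ball_volume_gamma R d d_gt0. Qed.

Lemma sphere_prob_ge0 A : 0 <= sphere_prob A.
Proof. by rewrite divr_ge0 ?fine_ge0// ltW. Qed.

Lemma sphere_prob_le A B : measurable A -> measurable B ->
  A `&` unit_sphere R d `<=` B -> sphere_prob A <= sphere_prob B.
Proof.
move=> mA mB AB; rewrite /sphere_prob ler_pM2r ?invr_gt0//.
apply: fine_le; rewrite ?sphere_measure_fin//.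
apply: (@le_measure _ _ _ (lebesgue_tuple d) (cone_over A) (cone_over B)); rewrite ?inE.
- exact: measurable_cone_over.
- exact: measurable_cone_over.
move=> y [Ay /[dup] Py /andP[y0 _]]; split => //.
by apply: AB; split => //; exact: enorm_normalize.
Qed.

Lemma sphere_prob_setT : sphere_prob setT = 1.
Proof.
rewrite /sphere_prob /sphere_measure /cone_over preimage_setT setTI.
by rewrite punctured_ball_volume/= divff// gt_eqF.
Qed.

Lemma sphere_prob_label (I : finType) (c : d.-tuple R -> I) (J : pred I) :
  (forall i, measurable (c @^-1` [set i])) ->
  sphere_prob [set x | J (c x)] = \sum_(i | J i) sphere_prob (c @^-1` [set i]).
Proof.
move=> mc; rewrite /sphere_prob measure_label// -mulr_suml; congr (_ / _).
by rewrite sum_fine// => i _; exact: sphere_measure_fin.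
Qed.

Lemma intensityE (gamma : R) A : measurable A ->
  (gamma%:E * (surface_measure A / surface_measure (unit_sphere R d)) =
   (gamma * sphere_prob A)%:E)%E.
Proof.
move=> mA; have dn0 : d%:R != 0 :> R by rewrite pnatr_eq0 -lt0n.
have k0 : @ball_volume R d != 0 by rewrite gt_eqF.
rewrite /surface_measure -{2}(setTI (unit_sphere R d)).
rewrite -setIA setIid !cone_sphereE !lebesgue_RdE; [|exact: measurable_cone_over..].
have -> : cone_over setT = punctured_ball by rewrite /cone_over preimage_setT setTI.
have -> : lebesgue_tuple d (cone_over A) = (fine (sphere_measure A))%:E.
  by rewrite fineK//; exact: sphere_measure_fin.
rewrite punctured_ball_volume -!EFinM inver.
rewrite mulf_eq0 (negbTE dn0) (negbTE k0)/= -!EFinM; congr EFin.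
by rewrite /sphere_prob; field; rewrite dn0 k0.
Qed.

End SphereMeasure.

(** * Distances and spherical caps *)

Section TupleMetric.
Context {R : realType} {d : nat}.
Implicit Types (x y z : d.-tuple R).
Local Notation dist := (@Defs.edist R d).

(** Expands the squared norm of x - (|x| / |y|) y. *)
Lemma dot_cauchy_schwarz x y : dot x y <= enorm x * enorm y.
Proof.
have [x0|x0] := eqVneq (enorm x) 0.
  have /dot_eq0 xi : dot x x = 0 by rewrite -sqr_enorm x0 expr0n.
  by rewrite x0 mul0r /dot big1// => i _; rewrite xi mul0r.
have [y0|y0] := eqVneq (enorm y) 0.
  have /dot_eq0 yi : dot y y = 0 by rewrite -sqr_enorm y0 expr0n.
  by rewrite y0 mulr0 /dot big1// => i _; rewrite yi mulr0.
have nx : 0 < enorm x by rewrite lt_neqAle eq_sym x0 enorm_ge0.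
have ny : 0 < enorm y by rewrite lt_neqAle eq_sym y0 enorm_ge0.
have := dot_ge0 (affine_tuple (- (enorm x / enorm y)) x y).
rewrite !(dot_affine, dot_affiner) -!sqr_enorm [dot y x]dotC.
set a := enorm x in nx *; set b := enorm y in ny *.
have -> : - (a / b) * (- (a / b) * b ^+ 2 + dot x y) + (- (a / b) * dot x y + a ^+ 2) =
  2 * (a / b) * (a * b - dot x y) by field; exact: lt0r_neq0.
have ab : 0 < 2 * (a / b) by rewrite mulr_gt0// divr_gt0.
by rewrite (pmulr_rge0 _ ab) subr_ge0.
Qed.

Lemma enorm_affine1 x y : enorm (affine_tuple 1 x y) <= enorm x + enorm y.
Proof.
rewrite enorm_le ?addr_ge0 ?enorm_ge0// !(dot_affine, dot_affiner) [dot y x]dotC.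
rewrite sqrrD !sqr_enorm; have := dot_cauchy_schwarz x y; lra.
Qed.

Lemma dist_ge0 x y : 0 <= dist x y.
Proof. exact: enorm_ge0. Qed.

Lemma dist_sym x y : dist x y = dist y x.
Proof.
rewrite !edistE !enormE !(dot_affine, dot_affiner) [dot y x]dotC.
congr Num.sqrt; ring.
Qed.

Lemma dist_triangle y x z : dist x z <= dist x y + dist y z.
Proof.
rewrite !edistE; apply: le_trans (enorm_affine1 _ _).
rewrite [leLHS](_ : _ = enorm (affine_tuple 1 (affine_tuple (-1) x y) (affine_tuple (-1) y z)))//.
by congr (enorm _); apply: eq_from_tnth => i; rewrite !tnth_affine; ring.
Qed.

Lemma le_dist (r : R) x y : 0 <= r -> (r <= dist x y) = (r ^+ 2 <= dot x x + dot y y - 2 * dot x y).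
Proof. by move=> r0; rewrite -sqr_edist ler_pXn2r// nnegrE dist_ge0. Qed.

Lemma dist_le_sum (r : R) x y : 0 <= r ->
  (forall i, `|tnth x i - tnth y i| <= r) -> dist x y <= d%:R * r.
Proof.
move=> r0 h; rewrite edistE enorm_le ?mulr_ge0// /dot.
have -> : (d%:R * r) ^+ 2 = \sum_(i < d) (d%:R * r ^+ 2).
  by rewrite sumr_const card_ord -mulr_natl; ring.
apply: ler_sum => i _; rewrite tnth_affine mulN1r addrC -expr2 -real_normK ?num_real//.
apply: (@le_trans _ _ (r ^+ 2)); first by rewrite ler_pXn2r// nnegrE.
rewrite ler_peMl ?sqr_ge0// ler1n; exact: leq_ltn_trans (leq0n i) (ltn_ord i).
Qed.

End TupleMetric.

Section Caps.
Context {R : realType} {d : nat}.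
Hypothesis d_gt0 : (0 < d)%N.
Implicit Types (x y : d.+1.-tuple R).
Local Notation dist := (@Defs.edist R d.+1).
Local Notation sphere := (unit_sphere R d.+1).
Local Notation prob := (@sphere_prob R d.+1).

Definition cap_prob (q : R) : R := prob [set y | q <= dot pole y].

Lemma measurable_cap x (q : R) : measurable [set y | q <= dot x y].
Proof.
rewrite (_ : [set y | _] = (fun y => dot x y) @^-1` `[q, +oo[%classic).
  by apply: measurable_preimageT => //; exact: measurable_dot.
by apply/seteqP; split => y /=; rewrite in_itv/= andbT.
Qed.

Lemma cone_over_cap x (q : R) : cone_over [set y | q <= dot x y] = cap_cone x q.
Proof.
apply/seteqP; split => y; rewrite /cone_over /cap_cone /normalize /punctured_ball/=.
  move=> [+ /[dup] y1 /andP[y0 _]]; rewrite dot_affiner [dot x zero_tuple]dotC dot0 addr0.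
  by rewrite mulrC ler_pdivlMr.
move=> [/[dup] y1 /andP[y0 _]]; rewrite dot_affiner [dot x zero_tuple]dotC dot0 addr0.
by rewrite [_^-1 * _]mulrC ler_pdivlMr.
Qed.

Lemma dot_pole_pole : dot (@pole R d) pole = 1.
Proof. by rewrite dot_cons mulr1 dot0 addr0. Qed.

(** All caps of the same radius have the same measure: a reflection moves the
    centre of one to the centre of the other. *)
Lemma sphere_prob_cap x (q : R) : enorm x = 1 ->
  prob [set y | q <= dot x y] = cap_prob q.
Proof.
move=> x1; rewrite /cap_prob /sphere_prob /sphere_measure !cone_over_cap.
by rewrite (cap_cone_reflection x pole)// dot_pole_pole -sqr_enorm x1 expr1n.
Qed.

(** The asymptotic ratio of the measure of a small cap to the d-th power of its
    angular radius; see cap_prob_bounds. *)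
Definition cap_constant : R := ball_volume d / (d.+1%:R * ball_volume d.+1).

Let k0 : 0 < @ball_volume R d.+1.
Proof. by have [_ ? _ _] := @ball_volume_gamma R d.+1 isT. Qed.

(** As q tends to 1 the two bounds become equivalent. *)
Lemma cap_prob_bounds (q : R) : 0 < q < 1 ->
  q ^+ d.+1 * (cap_constant * (Num.sqrt (1 - q ^+ 2) / q) ^+ d) <= cap_prob q <=
  cap_constant * (Num.sqrt (1 - q ^+ 2) / q) ^+ d.
Proof.
move=> q01; have := cap_cone_pole_le d_gt0 q q01; have := cap_cone_pole_ge d_gt0 q q01.
have fin : lebesgue_tuple d.+1 (cap_cone pole q) \is a fin_num.
  rewrite -cone_over_cap; apply: (sphere_measure_fin (ltn0Sn d)); exact: measurable_cap.
rewrite /cap_prob /sphere_prob /sphere_measure cone_over_cap.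
rewrite -(fineK fin) !lee_fin; set v := fine _; set tau := _ / q => ge le.
have cE : cap_constant * tau ^+ d = (tau ^+ d * ball_volume d / d.+1%:R) / ball_volume d.+1.
  rewrite /cap_constant; field.
  by rewrite nat1r pnatr_eq0 (gt_eqF k0).
rewrite cE; apply/andP; split; last by rewrite ler_pM2r ?invr_gt0.
by rewrite mulrA ler_pM2r ?invr_gt0.
Qed.

(** The probability that a uniform point of the sphere is at distance at least
    2 - r from a given one (sphere_prob_far), that is, within a small cap around
    the antipode: 1 - 2 r + r^2 / 2 is the cosine of its angle. *)
Definition far_prob (r : R) : R := cap_prob (1 - 2 * r + r ^+ 2 / 2).

Let unit_dot x : sphere x -> dot x x = 1.
Proof. by move=> x1; rewrite -sqr_enorm x1 expr1n. Qed.

Lemma far_cap (r : R) x y : r <= 2 -> sphere x -> sphere y ->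
  (2 - r <= dist x y) = (1 - 2 * r + r ^+ 2 / 2 <= dot (affine_tuple (-1) zero_tuple x) y).
Proof.
move=> r2 x1 y1; rewrite le_dist ?subr_ge0// !unit_dot// dot_affine dot0 addr0 mulN1r.
by apply/idP/idP => h; lra.
Qed.

Lemma measurable_dist x (r : R) : measurable [set y | r <= dist x y].
Proof.
have md : measurable_fun setT (fun y => dist x y).
  rewrite (_ : (fun _ => _) = @enorm R d.+1 \o affine_tuple (-1) x).
    apply: measurableT_comp; first exact: measurable_enorm.
    exact: measurable_affine_tuple.
  by apply/funext => y; rewrite /= edistE.
rewrite (_ : [set y | _] = (fun y => dist x y) @^-1` `[r, +oo[%classic).
  exact: measurable_preimageT.
by apply/seteqP; split => y /=; rewrite in_itv/= andbT.
Qed.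

Lemma sphere_prob_far x (r : R) : r <= 2 -> sphere x ->
  prob [set y | 2 - r <= dist x y] = far_prob r.
Proof.
move=> r2 x1; rewrite /far_prob -(sphere_prob_cap (affine_tuple (-1) zero_tuple x)); last first.
  rewrite enormE !(dot_affine, dot_affiner) !dot0 [dot x zero_tuple]dotC dot0 unit_dot//.
  by rewrite -[RHS]sqrtr1; congr Num.sqrt; ring.
apply/eqP; rewrite eq_le !sphere_prob_le//; try exact: measurable_cap; try exact: measurable_dist.
- by move=> y [/= + y1]; rewrite far_cap.
- by move=> y [/= + y1]; rewrite far_cap.
Qed.

(** Points close to x are far from the antipode of x; this bounds the measure of
    a small cell by the same quantity far_prob that measures edges. *)
Lemma sphere_prob_near x (r : R) (A : set (d.+1.-tuple R)) :
  measurable A -> 0 <= r <= 1 -> sphere x ->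
  (forall y, A y -> sphere y -> dist x y <= r) -> prob A <= far_prob r.
Proof.
move=> mA /andP[r0 r1] x1 Ar; rewrite /far_prob -(sphere_prob_cap x)//.
apply: sphere_prob_le => //; first exact: measurable_cap.
move=> y [Ay y1] /=; have /= h := Ar y Ay y1.
have : dist x y ^+ 2 <= r ^+ 2 by rewrite ler_pXn2r// nnegrE dist_ge0.
rewrite sqr_edist !unit_dot//.
have : r ^+ 2 <= r by rewrite expr2 ler_piMl.
lra.
Qed.

End Caps.

(** * Cells of the sphere and their occupation by a Poisson process *)

Section Cells.
Context {R : realType} {d : nat}.
Local Notation dist := (@Defs.edist R d).
Local Notation sphere := (unit_sphere R d).

(** Records on which side of each of the hyperplanes x_i = j / (N + 1) - 1 the
    point x lies; the labels are the cells of a cubic grid. *)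
Definition threshold_label (N : nat) (x : d.-tuple R) :
    {ffun 'I_d * 'I_(2 * N.+1).+1 -> bool} :=
  [ffun ij : 'I_d * 'I_(2 * N.+1).+1 => (ij.2 : nat)%:R / N.+1%:R - 1 <= tnth x ij.1].

Lemma measurable_threshold_label (N : nat) l :
  measurable (threshold_label N @^-1` [set l]).
Proof.
rewrite (_ : _ @^-1` _ = \bigcap_(ij in [set: 'I_d * 'I_(2 * N.+1).+1])
   [set x : d.-tuple R | ((ij.2 : nat)%:R / N.+1%:R - 1 <= tnth x ij.1) = l ij]).
  apply: fin_bigcap_measurable => // -[i j] _ /=.
  rewrite (_ : [set x | _] = (fun x : d.-tuple R => j%:R / N.+1%:R - 1 <= tnth x i)
     @^-1` [set l (i, j)])//.
  apply: measurable_preimageT => //.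
  by apply: measurable_fun_ler => //; exact: measurable_tnth.
apply/seteqP; split => x /=.
  by move=> <- ij _; rewrite ffunE.
by move=> h; apply/ffunP => ij; rewrite ffunE; exact: h.
Qed.

Lemma sphere_coord x i : sphere x -> -1 <= tnth x i <= 1.
Proof.
move=> x1; rewrite -ler_norml -(@ler_pXn2r _ 2)// ?nnegrE// expr1n real_normK ?num_real//.
have : dot x x = 1 by rewrite -sqr_enorm x1 expr1n.
rewrite /dot (bigD1 i)//= -expr2 => <-.
by rewrite lerDl sumr_ge0// => j _; rewrite -expr2 sqr_ge0.
Qed.

Lemma threshold_label_coord (N : nat) x y i : sphere x -> sphere y ->
  threshold_label N x = threshold_label N y ->
  tnth y i - tnth x i <= N.+1%:R^-1.
Proof.
move=> x1 y1 xy; have /andP[xN xle] := sphere_coord x i x1.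
have /andP[_ yle] := sphere_coord y i y1.
rewrite leNgt; apply/negP => lt.
set a := tnth x i in xN xle lt; set b := tnth y i in yle lt.
have N0 : 0 < N.+1%:R :> R by rewrite ltr0n.
have z0 : 0 <= N.+1%:R * (a + 1) by rewrite mulr_ge0//; lra.
have /andP[kle ltk] := Num.Theory.truncn_itv z0.
set k := Num.truncn _ in kle ltk.
(* the grid point just above a separates a from b *)
have ak : a < k.+1%:R / N.+1%:R - 1 by rewrite ltrBrDr ltr_pdivlMr// mulrC.
have kb : k.+1%:R / N.+1%:R - 1 <= b.
  rewrite lerBlDr ler_pdivrMr// -natr1 mulrC.
  apply: (@le_trans _ _ (N.+1%:R * (a + 1) + 1)); first by rewrite lerD2r.
  have : N.+1%:R * N.+1%:R^-1 <= N.+1%:R * (b - a) by rewrite ler_pM2l// ltW.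
  by rewrite divff ?gt_eqF//; lra.
have kN : (k.+1 < (2 * N.+1).+1)%N.
  rewrite ltnS -(ler_nat R); apply: (@le_trans _ _ ((b + 1) * N.+1%:R)).
    by rewrite -ler_pdivrMr// -lerBlDr.
  by rewrite natrM ler_pM2r//; lra.
have := congr1 (fun f : {ffun _ -> bool} => f (i, Ordinal kN)) xy.
by rewrite !ffunE/= kb leNgt ak.
Qed.

Lemma fine_partition (delta : R) : 0 < delta ->
  exists (m : nat) (c : d.-tuple R -> 'I_m),
    (forall i, measurable (c @^-1` [set i])) /\
    (forall x y, sphere x -> sphere y -> c x = c y -> dist x y <= delta).
Proof.
move=> d0; have dd0 : 0 < delta / d.+1%:R by rewrite divr_gt0.
have [N] := ltr_add_invr dd0; rewrite add0r => Nd.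
pose T := {ffun 'I_d * 'I_(2 * N.+1).+1 -> bool}.
exists #|T|, (fun x => enum_rank (threshold_label N x)); split.
  move=> i; rewrite (_ : _ @^-1` _ = threshold_label N @^-1` [set enum_val i]).
    exact: measurable_threshold_label.
  apply/seteqP; split => x /=; first by move=> <-; rewrite enum_rankK.
  by move=> ->; rewrite enum_valK.
move=> x y x1 y1 /enum_rank_inj xy.
apply: (@le_trans _ _ (d%:R * N.+1%:R^-1)).
  apply: dist_le_sum => // i; rewrite ler_norml lerNl opprB.
  by rewrite !(threshold_label_coord N)// xy.
apply: (@le_trans _ _ (d.+1%:R * (delta / d.+1%:R))); last by rewrite mulrC divfK.
by rewrite ler_pM// ?ler_nat// ltW.
Qed.

End Cells.

Section OccupiedCells.
Context {R : realType} {d : nat} {dO : measure_display} {Omega : measurableType dO}.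
Hypothesis d_gt0 : (0 < d)%N.
Variables (P : probability Omega R) (gamma : R) (Pi : Omega -> set (d.-tuple R)).
Hypothesis hPi : homogeneous_poisson_sphere P gamma Pi.
Context {m : nat} (c : d.-tuple R -> 'I_m).
Hypothesis mc : forall i, measurable (c @^-1` [set i]).

(** The random set of cells that contain a point of the process. The cells
    being disjoint, it contains each of them independently, with the
    probability occupied_prob that a Poisson variable is not 0. *)
Definition occupied (w : Omega) : {set 'I_m} :=
  [set i | `[< exists2 x, Pi w x & c x = i >]]%SET.

Definition occupied_prob (i : 'I_m) : R :=
  1 - expR (- (gamma * sphere_prob (c @^-1` [set i]))).

Lemma npoints_eq0 (A : set (d.-tuple R)) w :
  npoints R Pi A w = 0%E <-> Pi w `&` A = set0.
Proof.
rewrite /npoints /counting; case: asboolP => [fin|inf]; last first.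
  by split => // A0; case: inf; rewrite A0; exact: finite_set0.
split => [[] /eqP|->]; last by rewrite fset_set0.
by rewrite pnatr_eq0 finmap.cardfs_eq0 => /eqP; exact: fset_set_set0.
Qed.

Let occupied_event (S : {set 'I_m}) (i : 'I_m) : set \bar R :=
  if i \in S then ~` [set 0%E] else [set 0%E].

Let measurable_occupied_event S i : measurable (occupied_event S i).
Proof.
rewrite /occupied_event; case: ifP => _; last exact: emeasurable_set1.
by apply: measurableC; exact: emeasurable_set1.
Qed.

Let npoints_cell i := npoints R Pi (c @^-1` [set i]).

Let occupiedE (S : {set 'I_m}) :
  occupied @^-1` [set S] =
  \bigcap_(i in [set: 'I_m]) (npoints_cell i @^-1` occupied_event S i).
Proof.
have cellP w i : (i \in occupied w) = ~~ `[< npoints_cell i w = 0%E >].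
  rewrite /occupied mathcomp.boot.finset.inE; apply/idP/negP => [/asboolP[x Px xi]|].
    by move=> /asboolP/npoints_eq0 E; have : set0 x by rewrite -E.
  move=> h; apply/asboolP; apply: contra_notP h => h; apply/asboolP/npoints_eq0.
  by apply/seteqP; split => // x [Px /= xi]; apply: h; exists x.
apply/seteqP; split => w /=.
  move=> <- i _; rewrite /occupied_event cellP/=.
  by case: asboolP => /= h.
move=> h; apply/setP => i; have := h i Logic.I; rewrite /occupied_event cellP /=.
case: (i \in S) => /=; first by move=> /asboolPn ->.
by move=> /asboolP ->.
Qed.

Let measurable_npoints_cell i : measurable_fun setT (npoints_cell i).
Proof. by have [_ [h _ _]] := hPi; exact: h. Qed.

Lemma measurable_occupied S : measurable (occupied @^-1` [set S]).
Proof.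
rewrite occupiedE; apply: fin_bigcap_measurable => // i _.
by apply: measurable_preimageT => //; exact: measurable_npoints_cell.
Qed.

Let prob_npoints_cell_eq0 i :
  P (npoints_cell i @^-1` [set 0%E]) = (1 - occupied_prob i)%:E.
Proof.
have [_ [_ h _]] := hPi; have := h _ (mc i) 0%N.
rewrite intensityE// expr0 fact0 divr1 mul1r => E.
by rewrite /occupied_prob opprB addrC subrK -E.
Qed.

Let prob_occupied_event S i :
  P (npoints_cell i @^-1` occupied_event S i) =
  (if i \in S then occupied_prob i else 1 - occupied_prob i)%:E.
Proof.
rewrite /occupied_event; case: ifP => _; last exact: prob_npoints_cell_eq0.
rewrite -preimage_setC probability_setC; last first.
  by apply: measurable_preimageT; [exact: measurable_npoints_cell|exact: emeasurable_set1].
by rewrite prob_npoints_cell_eq0 -EFinB; congr EFin; ring.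
Qed.

Lemma prob_occupied (Q : pred {set 'I_m}) :
  P [set w | Q (occupied w)] = (\sum_(S | Q S) subset_weight occupied_prob S)%:E.
Proof.
rewrite measure_label; last exact: measurable_occupied.
rewrite -sumEFin; apply: eq_bigr => S _; rewrite occupiedE.
have [_ [_ _ h]] := hPi.
have tc : trivIset setT (fun i => c @^-1` [set i]).
  by apply/trivIsetP => i j _ _ ij; apply/seteqP; split => // x [/= xi xj];
     rewrite -xi -xj eqxx in ij.
have := h m (fun i => c @^-1` [set i]) mc tc (occupied_event S).
move=> /(_ (measurable_occupied_event S))/(@etrans _ _ _ _); apply.
rewrite /subset_weight -prodEFin; apply: eq_bigr => i _.
exact: prob_occupied_event.
Qed.

End OccupiedCells.

(** * The law of the diameter at a fixed intensity *)

Section Diameter.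
Context {R : realType} {d : nat}.
Local Notation dist := (@Defs.edist R d).
Local Notation sphere := (unit_sphere R d).

Lemma dist_sphere_le2 x y : sphere x -> sphere y -> dist x y <= 2.
Proof.
move=> x1 y1; apply: le_trans (dist_triangle zero_tuple x y) _.
have d0 (z : d.-tuple R) : dist z zero_tuple = enorm z.
  by rewrite edistE !enormE !(dot_affine, dot_affiner) !dot0 [dot z _]dotC dot0;
    congr Num.sqrt; ring.
by rewrite (dist_sym zero_tuple) !d0 x1 y1.
Qed.

(** The approximation by b - e is needed because the process may be infinite
    on a null event, where the supremum may not be attained. Positivity of b
    excludes the empty set. *)
Lemma diam_ge (F : set (d.-tuple R)) (b : R) : F `<=` sphere -> 0 < b ->
  (b <= diam F) <->
  (forall e, 0 < e -> exists x y, [/\ F x, F y & b - e < dist x y]).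
Proof.
move=> FS b0; rewrite /diam; set D := [set _ | _ in _].
have [F0|/set0P[z Fz]] := eqVneq F set0.
  have D0 : D = set0 by apply/seteqP; split => // _ [[x y] /= [+ _] _]; rewrite F0.
  rewrite D0 sup0; split; first by move=> /(lt_le_trans b0); rewrite ltxx.
  by move=> /(_ 1 ltr01)[x [y []]]; rewrite F0.
have DS : has_sup D.
  split; first by exists (dist z z), (z, z).
  by exists 2 => _ [[x y] /= [Fx Fy] <-]; apply: dist_sphere_le2; exact: FS.
split=> [bD e e0|h].
  have [_ [[x y] /= [Fx Fy] <-] lt] := sup_adherent e0 DS.
  by exists x, y; split => //; apply: le_lt_trans lt; rewrite lerD2r.
apply/ler_addgt0Pr => e e0; have [x [y [Fx Fy lt]]] := h e e0.
rewrite -lerBlDr; apply: le_trans (ltW lt) _.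
by apply: sup_upper_bound => //; exists (x, y).
Qed.

End Diameter.

Section DiameterEvent.
Context {R : realType} {d : nat} {dO : measure_display} {Omega : measurableType dO}.
Hypothesis d_gt0 : (0 < d)%N.
Local Notation dist := (@Defs.edist R d.+1).
Local Notation sphere := (unit_sphere R d.+1).
Variables (P : probability Omega R) (gamma : R) (Pi : Omega -> set (d.+1.-tuple R)).
Hypothesis gamma_ge0 : 0 <= gamma.
Hypothesis hPi : homogeneous_poisson_sphere P gamma Pi.

Let PiS w : Pi w `<=` sphere. Proof. by have [h _] := hPi; exact: h. Qed.

Lemma mem_occupied {m : nat} (c : d.+1.-tuple R -> 'I_m) w i :
  reflect (exists2 x, Pi w x & c x = i) (i \in occupied Pi c w).
Proof. by rewrite mathcomp.boot.finset.inE; exact: asboolP. Qed.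

(** The points of the process are seen only through the numbers of points in
    measurable sets; a pair at distance more than a is detected by a pair of
    occupied cells of a fine enough partition, all of whose points are that far
    apart. *)
Lemma measurable_far_pair (a : R) :
  measurable [set w | exists x y, [/\ Pi w x, Pi w y & a < dist x y]].
Proof.
have /choice[f hf] : forall k : nat, exists mc : {m : nat & d.+1.-tuple R -> 'I_m},
    (forall i, measurable (projT2 mc @^-1` [set i])) /\
    (forall x y, sphere x -> sphere y -> projT2 mc x = projT2 mc y ->
       dist x y <= k.+1%:R^-1).
  move=> k; have [|m [c [mc hc]]] := @fine_partition R d.+1 k.+1%:R^-1; first by rewrite invr_gt0.
  by exists (existT _ m c).
pose Q k (S : {set 'I_(projT1 (f k))}) : bool := [exists i in S, exists j in S,
  `[< forall x y, sphere x -> sphere y -> projT2 (f k) x = i -> projT2 (f k) y = j ->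
        a < dist x y >]].
rewrite (_ : [set w | _] = \bigcup_k [set w | Q k (occupied Pi (projT2 (f k)) w)]).
  apply: bigcupT_measurable => k; have [mc _] := hf k.
  apply: (measurable_label (occupied Pi (projT2 (f k))) _ (Q k)) => S.
  exact: (measurable_occupied P gamma Pi hPi).
apply/seteqP; split => w /=.
  move=> [x [y [Px Py lt]]].
  have e0 : 0 < (dist x y - a) / 2 by rewrite divr_gt0// subr_gt0.
  have [k] := ltr_add_invr e0; rewrite add0r => ke.
  exists k => //; have [_ hc] := hf k.
  apply/exists_inP; exists (projT2 (f k) x); first by apply/mem_occupied; exists x.
  apply/exists_inP; exists (projT2 (f k) y); first by apply/mem_occupied; exists y.
  apply/asboolP => x' y' x1 y1 xx yy.
  have dx : dist x x' <= k.+1%:R^-1 by apply: hc => //; exact: PiS Px.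
  have dy : dist y' y <= k.+1%:R^-1 by apply: hc => //; exact: PiS Py.
  have := dist_triangle x' x y; have := dist_triangle y' x' y.
  by move: ke dx dy lt; set e := _^-1; move=> *; lra.
move=> [k _ /exists_inP[i /mem_occupied[x Px xi]] /exists_inP[j /mem_occupied[y Py yj]]].
move=> /asboolP h; exists x, y; split => //; apply: h => //; [exact: PiS Px|exact: PiS Py].
Qed.

Lemma measurable_diam_ge (b : R) : 0 < b -> measurable [set w | b <= diam (Pi w)].
Proof.
move=> b0; rewrite (_ : [set w | _] = \bigcap_(k in [set: nat])
  [set w | exists x y, [/\ Pi w x, Pi w y & b - k.+1%:R^-1 < dist x y]]).
  by apply: bigcapT_measurable => k; exact: measurable_far_pair.
apply/seteqP; split => w /=.
  by move=> /(diam_ge _ _ (PiS w) b0) h k _; apply: h; rewrite invr_gt0.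
move=> h; apply/(diam_ge _ _ (PiS w) b0) => e e0.
have [k] := ltr_add_invr e0; rewrite add0r => ke.
have [x [y [Px Py lt]]] := h k Logic.I; exists x, y; split => //.
by apply: lt_trans lt; rewrite ltrD2l ltrN2.
Qed.

Variables (s delta : R).
Hypothesis delta_gt0 : 0 < delta.
Hypothesis delta_le : 2 * delta <= s.
Hypothesis s_le : s + 3 * delta <= 1.
Context {m : nat} (c : d.+1.-tuple R -> 'I_m).
Hypothesis mc : forall i, measurable (c @^-1` [set i]).
Hypothesis hc : forall x y, sphere x -> sphere y -> c x = c y -> dist x y <= delta.

Let mesh_bounds : [/\ 0 < delta, 2 * delta <= s & s + 3 * delta <= 1].
Proof. by []. Qed.

Local Notation prob := (@sphere_prob R d.+1).
Local Notation p := (occupied_prob gamma c).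
Let lam i : R := gamma * prob (c @^-1` [set i]).

Let lam_ge0 i : 0 <= lam i. Proof. by rewrite mulr_ge0// sphere_prob_ge0. Qed.

Let p01 i : 0 <= p i <= 1.
Proof.
rewrite /occupied_prob subr_ge0 lerBlDr lerDl expR_ge0 andbT.
by rewrite -expR0 ler_expR oppr_le0; exact: lam_ge0.
Qed.

Let p_le_lam i : p i <= lam i.
Proof. by rewrite /occupied_prob; have := expR_ge1Dx (- lam i); rewrite /lam; lra. Qed.

Let p_ge_lam i : lam i * (1 - lam i) <= p i.
Proof.
have l0 := lam_ge0 i; rewrite /occupied_prob -/(lam i) expRN.
have e1 := expR_ge1Dx (lam i).
have : (expR (lam i))^-1 <= (1 + lam i)^-1 by rewrite lef_pV2 ?posrE ?expR_gt0//; lra.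
have -> : (1 + lam i)^-1 = 1 - lam i / (1 + lam i) by field; apply: lt0r_neq0; lra.
have : lam i * (1 - lam i) <= lam i / (1 + lam i).
  by rewrite ler_pdivlMr; nra.
lra.
Qed.

Let nonempty_cell i : Prop := exists2 x, sphere x & c x = i.

Let empty_lam i : ~ nonempty_cell i -> lam i = 0.
Proof.
move=> ne; rewrite /lam (_ : prob _ = 0) ?mulr0//; apply/eqP.
rewrite eq_le sphere_prob_ge0// andbT.
have <- : prob set0 = 0 by rewrite /sphere_prob measure0/= mul0r.
by apply: sphere_prob_le => // x [/= xi x1]; apply: ne; exists x.
Qed.

Let sum_lam (J : pred 'I_m) : \sum_(i | J i) lam i = gamma * prob [set x | J (c x)].
Proof. by rewrite -mulr_sumr sphere_prob_label. Qed.

Let sum_lamT : \sum_i lam i = gamma.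
Proof.
rewrite (sum_lam predT) (_ : [set x | _] = setT) ?sphere_prob_setT ?mulr1//.
exact/seteqP.
Qed.

Let measurable_cells (J : pred 'I_m) : measurable [set x | J (c x)].
Proof. exact: measurable_label. Qed.

Local Notation eta := (gamma * @far_prob R d s).

Let far_prob_ge0 r : 0 <= @far_prob R d r.
Proof. exact: sphere_prob_ge0. Qed.

Let gamma_far_ge0 r : 0 <= gamma * @far_prob R d r.
Proof. by apply: mulr_ge0 => //; exact: far_prob_ge0. Qed.

Let lam_le i : lam i <= eta.
Proof.
have [dl0 dls s1] := mesh_bounds.
have [[x x1 xi]|/empty_lam ->] := pselect (nonempty_cell i); last by rewrite mulr_ge0.
rewrite ler_wpM2l//; apply: (sphere_prob_near x) => //; first by apply/andP; split; lra.
by move=> y /= yi y1; apply: le_trans (hc x y x1 y1 _) _; [rewrite xi yi|lra].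
Qed.

(** Two graphs on the cells of the partition c, of mesh delta. A pair of points
    of the process at distance close to 2 - s occupies an edge of may_be_far, and
    an occupied edge of must_be_far contains such a pair, so that the two graphs
    bound the event on the diameter from both sides. *)
Definition may_be_far (i j : 'I_m) : bool :=
  `[< exists x y, [/\ sphere x, sphere y, c x = i, c y = j & 2 - s - delta < dist x y] >].

Definition must_be_far (i j : 'I_m) : bool :=
  `[< [/\ nonempty_cell i, nonempty_cell j &
      forall x y, sphere x -> sphere y -> c x = i -> c y = j -> 2 - s <= dist x y] >].

Let may_sym : symmetric may_be_far.
Proof.
by move=> i j; apply/asboolP/asboolP => -[x [y [x1 y1 xi yj lt]]]; exists y, x; rewrite dist_sym.
Qed.

Let may_irr : irreflexive may_be_far.
Proof.
have [dl0 dls s1] := mesh_bounds.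
move=> i; apply/asboolP => -[x [y [x1 y1 xi yi]]].
have : dist x y <= delta by apply: hc => //; rewrite xi yi.
lra.
Qed.

Let must_sym : symmetric must_be_far.
Proof.
by move=> i j; apply/asboolP/asboolP => -[ni nj h]; split => // x y x1 y1 xi yj;
   rewrite dist_sym; exact: h.
Qed.

Let must_irr : irreflexive must_be_far.
Proof.
have [dl0 dls s1] := mesh_bounds.
move=> i; apply/asboolP => -[[x x1 xi] _ h].
have := h x x x1 x1 xi xi; have : dist x x <= delta by exact: hc.
lra.
Qed.

Let may_mean_le : edge_mean p may_be_far <= gamma ^+ 2 * @far_prob R d (s + 3 * delta) / 2.
Proof.
have [dl0 dls s1] := mesh_bounds.
rewrite /edge_mean [leRHS]mulrC mul1r ler_pM2l ?invr_gt0//.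
apply: (@le_trans _ _ (\sum_i lam i * (gamma * @far_prob R d (s + 3 * delta)))); last first.
  by rewrite -mulr_suml sum_lamT expr2 mulrA.
apply: ler_sum => i _.
apply: (@le_trans _ _ (lam i * \sum_(j | may_be_far i j) lam j)).
  rewrite mulr_sumr; apply: ler_sum => j _.
  by apply: ler_pM => //; [have /andP[] := p01 i|have /andP[] := p01 j].
rewrite ler_wpM2l//.
have [[x x1 xi]|ne] := pselect (nonempty_cell i); last first.
  rewrite big1 ?gamma_far_ge0// => j /asboolP[x [y [x1 _ xi _ _]]].
  by exfalso; apply: ne; exists x.
rewrite sum_lam ler_wpM2l// -(sphere_prob_far x)//; last by lra.
apply: sphere_prob_le => //; first exact: measurable_dist.
move=> y [/= /asboolP[x' [y' [x1' y1' xi' yj' lt]]] y1].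
have : dist x' x <= delta by apply: hc => //; rewrite xi'.
have : dist y y' <= delta by apply: hc.
have := dist_triangle x x' y'; have := dist_triangle y x y'.
lra.
Qed.

Let must_degree_le i : \sum_(j | must_be_far i j) p j <= eta.
Proof.
have [dl0 dls s1] := mesh_bounds.
apply: (@le_trans _ _ (\sum_(j | must_be_far i j) lam j)); first exact: ler_sum.
have [[x x1 xi]|ne] := pselect (nonempty_cell i); last first.
  by rewrite big1 ?gamma_far_ge0// => j /asboolP[].
rewrite sum_lam ler_wpM2l// -(sphere_prob_far x)//; last by lra.
apply: sphere_prob_le => //; first exact: measurable_dist.
by move=> y [/= /asboolP[_ _ h] y1]; exact: h.
Qed.

Let must_mean_ge : eta <= 1 ->
  (1 - eta) ^+ 2 * (gamma ^+ 2 * @far_prob R d (s - 2 * delta) / 2) <= edge_mean p must_be_far.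
Proof.
have [dl0 dls s1] := mesh_bounds.
move=> eta1; rewrite /edge_mean mulrA [leLHS]mulrC mul1r ler_pM2l ?invr_gt0//.
apply: (@le_trans _ _ (\sum_i (1 - eta) ^+ 2 * (lam i * (gamma * @far_prob R d (s - 2 * delta))))).
  by rewrite -mulr_sumr -mulr_suml sum_lamT expr2 mulrA mulrA expr2 !mulrA.
apply: ler_sum => i _.
apply: (@le_trans _ _ ((1 - eta) ^+ 2 * (lam i * \sum_(j | must_be_far i j) lam j))).
  rewrite ler_wpM2l ?sqr_ge0//.
  have [[x x1 xi]|/empty_lam ->] := pselect (nonempty_cell i); last by rewrite !mul0r.
  rewrite ler_wpM2l// sum_lam ler_wpM2l// -(sphere_prob_far x)//; last by lra.
  apply: sphere_prob_le => //; first exact: measurable_dist.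
  move=> y [/= far y1]; apply/asboolP; split; [by exists x|by exists y|].
  move=> x' y' x1' y1' xi' yi'.
  have : dist x x' <= delta by apply: hc => //; rewrite xi'.
  have : dist y' y <= delta by apply: hc.
  have := dist_triangle x' x y; have := dist_triangle y' x' y.
  lra.
rewrite !mulr_sumr; apply: ler_sum => j _.
have pl k : (1 - eta) * lam k <= p k.
  apply: le_trans (p_ge_lam k); rewrite mulrC ler_wpM2l//; have := lam_le k; lra.
rewrite (_ : _ * _ = ((1 - eta) * lam i) * ((1 - eta) * lam j)); last by ring.
by apply: ler_pM => //; rewrite mulr_ge0// subr_ge0.
Qed.

Let prob_hit (e : rel 'I_m) :
  P [set w | ~~ avoids (edges e) (occupied Pi c w)] = (1 - avoid_prob p (edges e))%:E.
Proof.
rewrite (prob_occupied (ltn0Sn d) P gamma Pi hPi c mc (fun S => ~~ avoids (edges e) S)).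
congr EFin; rewrite -(sum_subset_weight p) [in RHS](bigID (avoids (edges e)))/=.
by rewrite addrAC subrr add0r.
Qed.

(** An upper bound for the probability that the diameter is at least 2 - s is the
    probability that some edge of may_be_far is occupied. *)
Lemma diam_prob_le : eta < 1 ->
  (P [set w | (2 - s <= diam (Pi w))%R] <=
   (1 - expR (- (gamma ^+ 2 * @far_prob R d (s + 3 * delta) / 2 / (1 - eta))))%:E)%E.
Proof.
have [dl0 dls s1] := mesh_bounds.
move=> eta1; have s2 : 0 < 2 - s by lra.
apply: (@le_trans _ _ (P [set w | ~~ avoids (edges may_be_far) (occupied Pi c w)])).
  apply: le_measure; rewrite ?inE.
  - exact: measurable_diam_ge.
  - apply: (measurable_label (occupied Pi c) _ (fun S => ~~ avoids (edges may_be_far) S)).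
    by move=> S; exact: (measurable_occupied P gamma Pi hPi).
  move=> w /= /(diam_ge _ _ (PiS w) s2)/(_ delta delta_gt0)[x [y [Px Py lt]]].
  have ix : c x \in occupied Pi c w by apply/mem_occupied; exists x.
  have iy : c y \in occupied Pi c w by apply/mem_occupied; exists y.
  rewrite edges_avoids//; apply/negP => /forall_inP/(_ _ ix)/forall_inP/(_ _ iy)/negP.
  by apply; apply/asboolP; exists x, y; split => //; [exact: PiS Px|exact: PiS Py].
rewrite prob_hit lee_fin lerD2l lerN2.
apply: le_trans (avoid_edges_ge p may_be_far p01 may_sym may_irr _ eta1 _).
  by rewrite ler_expR lerN2 ler_pM2r ?invr_gt0 ?subr_gt0.
by move=> i; apply: le_trans (p_le_lam i) _.
Qed.

(** The counterpart of diam_prob_le for must_be_far. Given one occupied edge, the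
    expected number of occupied neighbours of an endpoint is at most
    gamma * far_prob s, which is the quantity that Janson's inequality requires
    to be small. *)
Lemma diam_prob_ge : eta <= 1 / 4 ->
  ((1 - expR (- ((1 - 4 * eta) *
      ((1 - eta) ^+ 2 * (gamma ^+ 2 * @far_prob R d (s - 2 * delta) / 2)))))%:E <=
   P [set w | (2 - s <= diam (Pi w))%R])%E.
Proof.
have [dl0 dls s1] := mesh_bounds.
move=> eta1; have s2 : 0 < 2 - s by lra.
apply: (@le_trans _ _ (P [set w | ~~ avoids (edges must_be_far) (occupied Pi c w)])); last first.
  apply: le_measure; rewrite ?inE.
  - apply: (measurable_label (occupied Pi c) _ (fun S => ~~ avoids (edges must_be_far) S)).
    by move=> S; exact: (measurable_occupied P gamma Pi hPi).
  - exact: measurable_diam_ge.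
  move=> w /=; rewrite edges_avoids// negb_forall_in => /exists_inP[i /mem_occupied[x Px xi]].
  rewrite negb_forall_in => /exists_inP[j /mem_occupied[y Py yj]].
  rewrite negbK => /asboolP[_ _ h]; apply/(diam_ge _ _ (PiS w) s2) => e e0.
  exists x, y; split => //; have := h x y (PiS _ _ Px) (PiS _ _ Py) xi yj; lra.
rewrite prob_hit lee_fin lerD2l lerN2.
apply: le_trans (avoid_edges_le p must_be_far p01 must_sym must_irr eta _) _ => //.
rewrite ler_expR lerN2 ler_wpM2l//; first by lra.
by apply: must_mean_ge; lra.
Qed.

End DiameterEvent.

(** * The limit *)

Lemma cvg_exprn {R : realType} (u : nat -> R) (l : R) (k : nat) :
  u @ \oo --> l -> (fun n => u n ^+ k) @ \oo --> l ^+ k.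
Proof.
move=> ul; elim: k => [|k IH]; first by under eq_fun do rewrite expr0; exact: cvg_cst.
by under eq_fun do rewrite exprS; rewrite exprS; exact: cvgM.
Qed.

Lemma cvg_1BexpRN {R : realType} (u : nat -> R) (l : R) :
  u @ \oo --> l -> (fun n => 1 - expR (- u n)) @ \oo --> 1 - expR (- l).
Proof.
move=> ul; apply: cvgB; first exact: cvg_cst.
apply: (cvg_comp (fun n => - u n) expR _ (@continuous_expR R _)).
exact: cvgN.
Qed.

Lemma cvg_EFin_seq {R : realType} (u : nat -> R) (l : R) :
  u @ \oo --> l -> (fun n => (u n)%:E) @ \oo --> l%:E.
Proof. by move=> ul; apply: cvg_EFin; [exact: nearW|]. Qed.

Section Asymptotics.
Context {R : realType} {d : nat}.
Hypothesis d_gt0 : (0 < d)%N.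

(** The normalisation of the theorem at intensity n + 1 on the sphere of
    R^(d + 1). Indices are shifted by one so that no intensity is 0. *)
Definition scaling (n : nat) : R := n.+1%:R `^ (4 / d%:R).

Let d_gt0R : 0 < d%:R :> R. Proof. by rewrite ltr0n. Qed.

Lemma scaling_gt0 n : 0 < scaling n.
Proof. by rewrite powR_gt0// ltr0n. Qed.

Lemma scaling_inv_cvg0 : (fun n => (scaling n)^-1) @ \oo --> (0 : R).
Proof.
have e0 : 0 < 4 / d%:R :> R by rewrite divr_gt0.
rewrite (_ : (fun n => _) = (fun n => n.+1%:R^-1 `^ (4 / d%:R))); last first.
  by apply/funext => n; rewrite -[n.+1%:R^-1]powR_inv1// -powRrM mulN1r powRN.
have /cvg_at_rightP := powR_cvg0 e0; apply; split => [n|]; first by rewrite invr_gt0 ltr0n.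
exact: cvg_harmonic.
Qed.

Lemma scaling_sqrt n : Num.sqrt (scaling n) ^+ d = n.+1%:R ^+ 2.
Proof.
rewrite -powR12_sqrt ?powR_ge0// -powR_mulrn ?powR_ge0// -!powRrM.
rewrite (_ : 4 / d%:R * (2^-1 * d%:R) = 2%:R) ?powR_mulrn//.
by field; rewrite gt_eqF.
Qed.

Variable t : R.
Hypothesis t_gt0 : 0 < t.

(** With r the distance deficit, the squared tangent of the cap angle is
    equivalent to 4 r, and r is of order n^(-4/d). The factor rho absorbs the
    mesh of the partition, which is small compared with r. *)
Lemma far_prob_cvg (rho : nat -> R) : rho n @[n --> \oo] --> (1 : R) ->
  (fun n => n.+1%:R ^+ 2 * @far_prob R d (t / scaling n * rho n)) @ \oo -->
  @cap_constant R d * (2 * Num.sqrt t) ^+ d.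
Proof.
move=> rho1; pose r n := t / scaling n * rho n; pose q n := 1 - 2 * r n + r n ^+ 2 / 2.
have r0 : r @ \oo --> (0 : R).
  rewrite -(mul0r 1); apply: cvgM => //; rewrite -(mulr0 t).
  by apply: cvgM; [exact: cvg_cst|exact: scaling_inv_cvg0].
have r20 : (fun n => r n ^+ 2) @ \oo --> (0 : R).
  by have := cvg_exprn r 0 2 r0; rewrite expr0n.
have q1 : q @ \oo --> (1 : R).
  rewrite (_ : 1 = 1 - 2 * 0 + 0 / 2 :> R); last by rewrite mulr0 subr0 mul0r addr0.
  apply: cvgD; last by apply: cvgM => //; exact: cvg_cst.
  apply: cvgB; first exact: cvg_cst.
  by apply: cvgM => //; exact: cvg_cst.
pose tau n := Num.sqrt (1 - q n ^+ 2) / q n.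
have rho0 : \forall n \near \oo, 0 < rho n by apply: (cvgr_gt _ rho1); exact: ltr01.
have r_small : \forall n \near \oo, r n < 2^-1 by apply: (cvgr_lt _ r0); rewrite invr_gt0.
have q01 : \forall n \near \oo, 0 < q n < 1.
  near=> n.
  have rn0 : 0 < r n.
    by rewrite !mulr_gt0 ?invr_gt0 ?scaling_gt0//; near: n; exact: rho0.
  have rn1 : r n < 2^-1 by near: n; exact: r_small.
  have : r n * r n < r n * 2^-1 by rewrite ltr_pM2l.
  by rewrite /q expr2; move=> h; apply/andP; split; nra.
pose u n := n.+1%:R ^+ 2 * (@cap_constant R d * tau n ^+ d).
have uL : u @ \oo --> @cap_constant R d * (2 * Num.sqrt t) ^+ d.
  have -> : u = fun n => @cap_constant R d *
      (Num.sqrt (t * rho n * ((2 - r n / 2) * (2 - 2 * r n + r n ^+ 2 / 2))) / q n) ^+ d.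
    apply/funext => n; rewrite /u -scaling_sqrt mulrCA; congr (_ * _).
    rewrite -exprMn /tau mulrA -sqrtrM ?powR_ge0//; congr ((Num.sqrt _ / _) ^+ _).
    rewrite /q /r; set b := scaling n.
    have b0 : b != 0 by rewrite gt_eqF// scaling_gt0.
    by field.
  apply: cvgM; first exact: cvg_cst.
  apply: cvg_exprn; rewrite -[2 * Num.sqrt t]divr1; apply: cvgM; last by apply: cvgV.
  have -> : 2 * Num.sqrt t = Num.sqrt (t * 1 * ((2 - 0 / 2) * (2 - 2 * 0 + 0 / 2))).
    rewrite !mul0r mulr0 mulr1 !subr0 addr0 mulrC sqrtrM ?(ltW t_gt0)//.
    by congr (_ * _); rewrite -expr2 sqrtr_sqr ger0_norm.
  apply: (cvg_comp (fun n => t * rho n * ((2 - r n / 2) * (2 - 2 * r n + r n ^+ 2 / 2)))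
    (@Num.sqrt R) _ (@sqrt_continuous R _)).
  apply: cvgM; first by apply: cvgM => //; exact: cvg_cst.
  apply: cvgM.
    apply: cvgB; first exact: cvg_cst.
    by apply: cvgM => //; exact: cvg_cst.
  apply: cvgD; last by apply: cvgM => //; exact: cvg_cst.
  apply: cvgB; first exact: cvg_cst.
  by apply: cvgM => //; exact: cvg_cst.
have lL : (fun n => q n ^+ d.+1 * u n) @ \oo --> @cap_constant R d * (2 * Num.sqrt t) ^+ d.
  rewrite -[X in _ --> X]mul1r; apply: cvgM => //.
  by have := cvg_exprn q 1 d.+1 q1; rewrite expr1n.
apply: (squeeze_cvgr _ lL uL).
near=> n; have qn : 0 < q n < 1 by near: n; exact: q01.
have /andP[lo hi] := cap_prob_bounds d_gt0 _ qn.
rewrite /u mulrCA !ler_pM2l ?exprn_gt0 ?ltr0n//.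
by apply/andP; split.
Unshelve. all: by end_near. Qed.

End Asymptotics.

Section Limit.
Context {R : realType} {d : nat}.
Hypothesis d_gt0 : (0 < d)%N.
Variable t : R.
Hypothesis t_gt0 : 0 < t.

Local Notation far := (@far_prob R d).
Let s n : R := t / @scaling R d n.
Let delta n : R := s n / n.+2%:R.
Let eta n : R := n.+1%:R * far (s n).
Let L : R := @cap_constant R d * (2 * Num.sqrt t) ^+ d.

(** The bounds of diam_prob_ge and diam_prob_le when the mesh of the partition is
    s / (n + 2), negligible with respect to s. *)
Definition diam_prob_lower n : R := 1 - expR (- ((1 - 4 * eta n) *
  ((1 - eta n) ^+ 2 * (n.+1%:R ^+ 2 * far (s n - 2 * delta n) / 2)))).

Definition diam_prob_upper n : R := 1 - expR (- (n.+1%:R ^+ 2 *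
  far (s n + 3 * delta n) / 2 / (1 - eta n))).

Let s_gt0 n : 0 < s n.
Proof. by rewrite divr_gt0// scaling_gt0. Qed.

Let s_cvg0 : s @ \oo --> (0 : R).
Proof.
rewrite -(mulr0 t); apply: cvgM; first exact: cvg_cst.
exact: scaling_inv_cvg0.
Qed.

Let inv_cvg0 : (fun n => n.+2%:R^-1) @ \oo --> (0 : R).
Proof.
have := @cvg_harmonic R; rewrite -(cvg_shiftS (fun n => n.+1%:R^-1 : R)).
exact.
Qed.

Let far_cvg (k : R) :
  (fun n => n.+1%:R ^+ 2 * far (s n + k * delta n)) @ \oo --> L.
Proof.
rewrite (_ : (fun n => _) =
  (fun n => n.+1%:R ^+ 2 * far (t / @scaling R d n * (1 + k * n.+2%:R^-1)))).
  apply: far_prob_cvg => //.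
  rewrite -[X in _ --> X]addr0 -[X in _ --> _ + X](mulr0 k).
  apply: cvgD; first exact: cvg_cst.
  by apply: cvgM; [exact: cvg_cst|exact: inv_cvg0].
by apply/funext => n; congr (_ * far _); rewrite /delta /s; ring.
Qed.

Let eta_cvg0 : eta @ \oo --> (0 : R).
Proof.
rewrite (_ : eta = (fun n => n.+1%:R^-1 * (n.+1%:R ^+ 2 * far (s n + 0 * delta n)))).
  rewrite -(mul0r L); apply: cvgM; [exact: cvg_harmonic|exact: far_cvg].
apply/funext => n; rewrite /eta mul0r addr0; field.
by rewrite nat1r pnatr_eq0.
Qed.

Let limit : R := 1 - expR (- (L / 2)).

Lemma diam_prob_upper_cvg : diam_prob_upper @ \oo --> limit.
Proof.
apply: cvg_1BexpRN.
have -> : L / 2 = L / 2 / (1 - 0) by rewrite subr0 divr1.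
apply: cvgM.
  by apply: cvgM; [exact: far_cvg|exact: cvg_cst].
apply: cvgV; first by rewrite subr0.
by apply: cvgB => //; exact: cvg_cst.
Qed.

Lemma diam_prob_lower_cvg : diam_prob_lower @ \oo --> limit.
Proof.
apply: cvg_1BexpRN.
have -> : L / 2 = (1 - 4 * 0) * ((1 - 0) ^+ 2 * (L / 2)).
  by rewrite mulr0 !subr0 expr1n !mul1r.
apply: cvgM.
  apply: cvgB; first exact: cvg_cst.
  by apply: cvgM => //; exact: cvg_cst.
apply: cvgM.
  by apply: cvg_exprn; apply: cvgB => //; exact: cvg_cst.
apply: cvgM; last exact: cvg_cst.
have := far_cvg (- 2); rewrite (_ : (fun n => _) =
  (fun n => n.+1%:R ^+ 2 * far (s n - 2 * delta n)))//.
by apply/funext => n; rewrite mulNr.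
Qed.

Lemma diam_prob_bounds : \forall n \near \oo,
  forall (dO : measure_display) (Omega : measurableType dO)
    (P : probability Omega R) (Pi : Omega -> set (d.+1.-tuple R)),
    homogeneous_poisson_sphere P n.+1%:R Pi ->
    ((diam_prob_lower n)%:E <= P [set w | (2 - s n <= diam (Pi w))%R] <= (diam_prob_upper n)%:E)%E.
Proof.
near=> n => dO Omega P Pi hPi.
have eta4 : eta n <= 1 / 4.
  near: n; apply: (cvgr_le _ eta_cvg0); by rewrite divr_gt0.
have s4 : s n <= 1 / 4.
  near: n; apply: (cvgr_le _ s_cvg0); by rewrite divr_gt0.
have sn0 := s_gt0 n.
have d0 : 0 < delta n by rewrite divr_gt0// ltr0n.
have ds : 2 * delta n <= s n.
  have n2 : 2 / n.+2%:R <= 1 :> R by rewrite ler_pdivrMr ?ltr0n// mul1r ler_nat.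
  by rewrite /delta mulrCA ler_piMr// ltW.
have sd : s n + 3 * delta n <= 1 by lra.
have [m [c [mc hc]]] := @fine_partition R d.+1 _ d0.
apply/andP; split.
  by apply: (diam_prob_ge P _ Pi (ler0n _ _) hPi (s n) (delta n) d0 ds sd c mc hc).
apply: (diam_prob_le P _ Pi (ler0n _ _) hPi (s n) (delta n) d0 ds sd c mc hc).
by apply: le_lt_trans eta4 _; lra.
Unshelve. all: by end_near. Qed.

Lemma limit_constantE : limit =
  1 - expR (- (1 / 2 * limit_constant R d.+1 * t `^ ((d.+1%:R - 1) / 2))).
Proof.
rewrite /limit /L /limit_constant /cap_constant; congr (1 - expR (- _)).
have := @ball_volume_ratio R d.+1 d_gt0; rewrite /= => ->.
have dE : d.+1%:R - 1 = d%:R :> R by rewrite -natr1 addrK.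
rewrite !dE powR_mulrn// exprMn.
have -> : t `^ (d%:R / 2) = Num.sqrt t ^+ d.
  by rewrite -powR12_sqrt ?ltW// -powR_mulrn ?powR_ge0// -powRrM mulrC.
by ring.
Qed.

End Limit.

Theorem theorem5p2 (R : realType) (d : nat) (hd : (2 <= d)%N)
    (dO : nat -> measure_display)
    (Omega : forall n : nat, measurableType (dO n))
    (P : forall n : nat, probability (Omega n) R)
    (Pi : forall n : nat, Omega n -> set (d.-tuple R))
    (hPi : forall n : nat, homogeneous_poisson_sphere (P n) n%:R (Pi n))
    (t : R) (ht : 0 < t) :
  (fun n : nat =>
     P n [set w | n%:R `^ (4 / (d%:R - 1)) * (2 - diam (Pi n w)) <= t])
    @ \oo -->
  (1 - expR (- (1 / 2 * limit_constant R d * t `^ ((d%:R - 1) / 2))))%:E.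
Proof.
case: d hd Pi hPi => [//|d] d_gt0 Pi hPi.
have bounds : \forall n \near \oo, ((diam_prob_lower (d := d) t n)%:E <=
    P n.+1 [set w | (n.+1%:R `^ (4 / (d.+1%:R - 1)) * (2 - diam (Pi n.+1 w)) <= t)%R] <=
    (diam_prob_upper (d := d) t n)%:E)%E.
  apply: filterS (diam_prob_bounds d_gt0 t ht) => n /(_ _ _ (P n.+1) _ (hPi n.+1)).
  rewrite (_ : [set w | (2 - _ <= _)%R] = [set w |
    (n.+1%:R `^ (4 / (d.+1%:R - 1)) * (2 - diam (Pi n.+1 w)) <= t)%R])//.
  apply/funext => w /=; rewrite -[d.+1%:R]natr1 addrK -/(@scaling R d n).
  rewrite [scaling n * _]mulrC -ler_pdivlMr ?scaling_gt0//.
  by rewrite lerBlDr [in RHS]lerBlDr addrC.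
rewrite -limit_constantE// -cvg_shiftS.
have lo := cvg_EFin_seq _ _ (diam_prob_lower_cvg d_gt0 t ht).
have hi := cvg_EFin_seq _ _ (diam_prob_upper_cvg d_gt0 t ht).
exact: (squeeze_cvge bounds lo hi).
Qed.
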